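(* Let $K$ be any field, let $S=K[x_1,\dots,x_n]$, and let $G$ be a finite simple graph on the vertex set $[n]$ with edge ideal $I=I(G)\subset S$. Write $t_i=t_i(S/I)$. Then for all integers $a\geq 0$ with $a+4\leq \mathrm{pd}_S(S/I)$, $$t_{a+4}\leq t_a+t_4.$$
   Context: $S=K[x_1,\dots,x_n]$ is standard graded ($\deg(x_i)=1$). For a finite simple graph $G$ on $[n]=\{1,\dots,n\}$ with edge set $E(G)$, the edge ideal is $I(G)=\langle x_ix_j : \{i,j\}\in E(G)\rangle\subset S$. The graded Betti numbers are $\beta_{i,j}(S/I)=\dim_K \mathrm{Tor}_i^S(S/I,K)_j$; $\mathrm{pd}_S(S/I)$ is the projective dimension of $S/I$; and for $0\le i\le \mathrm{pd}_S(S/I)$, $t_i(S/I)=\max\{j : \beta_{i,j}(S/I)\neq 0\}$ is the maximal shift in homological degree $i$ of the minimal graded free $S$-resolution of $S/I$. *)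

(* Defs.v *)
From HB Require Import structures.
From mathcomp Require Import all_boot all_order all_algebra.
From mathcomp Require Import generic_quotient ring_quotient boolp mpoly.

Set Implicit Arguments.
Unset Strict Implicit.
Unset Printing Implicit Defensive.

Import GRing.Theory.
Local Open Scope ring_scope.
Local Open Scope quotient_scope.

Definition ideal_gen (R : comNzRingType) (gs : seq R) : {pred R} :=
  fun p => `[< exists c : 'I_(size gs) -> R, p = \sum_i c i * gs`_i >].

Lemma ideal_gen_zmod_closed (R : comNzRingType) (gs : seq R) :
  zmod_closed (ideal_gen gs).
Proof.
split=> [|x y /asboolP[c ->] /asboolP[d ->]]; apply/asboolP.
  by exists (fun=> 0); rewrite big1 // => i _; rewrite mul0r.
exists (fun i => c i - d i); rewrite -sumrB.
by apply: eq_bigr => i _; rewrite mulrBl.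
Qed.

HB.instance Definition _ (R : comNzRingType) (gs : seq R) :=
  GRing.isZmodClosed.Build R (ideal_gen gs) (ideal_gen_zmod_closed gs).

Lemma ideal_gen_mull (R : comNzRingType) (gs : seq R) (a p : R) :
  p \in ideal_gen gs -> a * p \in ideal_gen gs.
Proof.
move=> /asboolP[c ->]; apply/asboolP; exists (fun i => a * c i).
by rewrite mulr_sumr; apply: eq_bigr => i _; rewrite mulrA.
Qed.

(* ring_quotient only gives R / I a ring structure, and only for a proper
   ideal; here R / I carries the R-module structure a *: [p] = [a * p]. *)
Section QuotientModule.
Variables (R : comNzRingType) (gs : seq R).

Definition quot_module : Type := Quotient.quot (ideal_gen gs).
HB.instance Definition _ := GRing.Zmodule.on quot_module.

Definition quot_class (p : R) : quot_module :=
  \pi_(Quotient.quot (ideal_gen gs)) p.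

Definition quot_scale (a : R) (x : quot_module) : quot_module :=
  quot_class (a * repr (x : Quotient.quot (ideal_gen gs))).

Lemma quot_classP (p q : R) :
  (quot_class p = quot_class q) <-> (p - q \in ideal_gen gs).
Proof. by rewrite (Quotient.idealrBE (ideal_gen gs)); split => /eqP. Qed.

Lemma quot_class_surj (x : quot_module) : exists p, x = quot_class p.
Proof.
by exists (repr (x : Quotient.quot (ideal_gen gs))); rewrite /quot_class reprK.
Qed.

Lemma quot_classD : {morph quot_class : p q / p + q}.
Proof.
move=> p q; exact: (raddfD (\pi_(Quotient.quot (ideal_gen gs)))).
Qed.

Lemma quot_scaleE (a p : R) : quot_scale a (quot_class p) = quot_class (a * p).
Proof.
apply/quot_classP; rewrite -mulrBr ideal_gen_mull //.
by apply/quot_classP; rewrite /quot_class reprK.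
Qed.

Lemma quot_scaleA a b x : quot_scale a (quot_scale b x) = quot_scale (a * b) x.
Proof. by have [p ->] := quot_class_surj x; rewrite !quot_scaleE mulrA. Qed.

Lemma quot_scale1 : left_id 1 quot_scale.
Proof.
by move=> x; have [p ->] := quot_class_surj x; rewrite quot_scaleE mul1r.
Qed.

Lemma quot_scaleDr : right_distributive quot_scale +%R.
Proof.
move=> a x y; have [p ->] := quot_class_surj x; have [q ->] := quot_class_surj y.
by rewrite -quot_classD !quot_scaleE mulrDr quot_classD.
Qed.

Lemma quot_scaleDl x : {morph quot_scale^~ x : a b / a + b}.
Proof.
move=> a b; have [p ->] := quot_class_surj x.
by rewrite !quot_scaleE mulrDl quot_classD.
Qed.

HB.instance Definition _ := GRing.Zmodule_isLmodule.Build R quot_module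
  quot_scaleA quot_scale1 quot_scaleDr quot_scaleDl.

End QuotientModule.

Definition is_resolution (R : pzRingType) (M : lmodType R)
    (C : nat -> lmodType R) (d : forall i, {linear C i.+1 -> C i})
    (eps : {linear C 0%N -> M}) : Prop :=
  [/\ forall y : M, exists x, eps x = y,
      forall x, eps x = 0 <-> exists y, d 0%N y = x
    & forall i x, d i x = 0 <-> exists y, d i.+1 y = x].

Definition projective (R : pzRingType) (P : lmodType R) : Prop :=
  forall (M N : lmodType R) (f : {linear M -> N}) (g : {linear P -> N}),
    (forall y, exists x, f x = y) ->
    exists h : {linear P -> M}, forall x, f (h x) = g x.

Definition projdim_le (R : pzRingType) (M : lmodType R) (m : nat) : Prop :=
  exists (C : nat -> lmodType R) (d : forall i, {linear C i.+1 -> C i})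
         (eps : {linear C 0%N -> M}),
    [/\ is_resolution d eps, forall i, projective (C i)
      & forall i, (m < i)%N -> forall x : C i, x = 0].

(* "the projective dimension of M is (finite and equal to) m" *)
Definition is_projdim (R : pzRingType) (M : lmodType R) (m : nat) : Prop :=
  projdim_le M m /\ forall m', projdim_le M m' -> (m <= m')%N.

(* F_i = \bigoplus_(k < rk i) S(- shift i k), and the matrix diff i acts on row
   vectors, F_(i+1) -> F_i.  A nonzero entry (k, l) of diff i is homogeneous of
   degree shift i.+1 k - shift i l.  Shifts are taken in nat because S / I
   lives in nonnegative degrees; minimality is not required. *)
Record graded_free_resolution (K : fieldType) (n : nat)
    (gs : seq {mpoly K[n]}) := GradedFreeResolution {
  rk : nat -> nat;
  shift : forall i, 'I_(rk i) -> nat;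
  diff : forall i, 'M[{mpoly K[n]}]_(rk i.+1, rk i);
  aug : {linear 'rV[{mpoly K[n]}]_(rk 0) -> quot_module gs};
  diff_graded : forall i k l m, m \in msupp (diff i k l) ->
    (mdeg m + shift l)%N = shift k;
  aug_graded : forall k, exists2 p : {mpoly K[n]},
    p \is (shift k).-homog & aug (delta_mx 0 k) = quot_class gs p;
  gfr_exact : is_resolution (C := fun i => 'rV[{mpoly K[n]}]_(rk i))
                (fun i => mulmxr (diff i)) aug
}.

(* Tor_i^S(S/I, K)_j as the degree j part of the i-th homology of F ⊗_S K, where
   S -> K = S/(x_1, .., x_n) takes constant terms: F_i ⊗_S K = K^(rk i), graded
   by placing the k-th basis vector in degree shift i k. *)
Section Tor.
Variables (K : fieldType) (n : nat) (gs : seq {mpoly K[n]}).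
Variable F : graded_free_resolution gs.

Definition diffK (i : nat) : 'M[K]_(rk F i.+1, rk F i) :=
  map_mx (mcoeff 0%MM) (diff F i).

Definition degree_part (i j : nat) : 'M[K]_(rk F i) :=
  diag_mx (\row_k (shift k == j)%:R).

Definition Tor_cycles (i j : nat) : 'M[K]_(rk F i) :=
  match i with
  | 0%N => degree_part 0 j
  | i'.+1 => (degree_part i'.+1 j :&: kermx (diffK i'))%MS
  end.

Definition Tor_boundaries (i j : nat) : 'M[K]_(rk F i.+1, rk F i) :=
  degree_part i.+1 j *m diffK i.

Definition betti (i j : nat) : nat :=
  (\rank (Tor_cycles i j) - \rank (Tor_boundaries i j))%N.

(* max {j | betti i j != 0}: Tor_i can be nonzero only in degrees of the form
   shift i k, as F_i ⊗_S K vanishes in the others.  The value is 0 if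
   Tor_i = 0. *)
Definition max_shift (i : nat) : nat :=
  \max_(k < rk F i | betti i (shift k) != 0%N) shift k.

End Tor.

Definition edge_gens (K : fieldType) (n : nat) (e : rel 'I_n) :
    seq {mpoly K[n]} :=
  [seq 'X_p.1 * 'X_p.2 | p <- enum [pred p : 'I_n * 'I_n | e p.1 p.2]].

Definition edge_quotient (K : fieldType) (n : nat) (e : rel 'I_n) :
    lmodType {mpoly K[n]} :=
  quot_module (edge_gens K e).

(* Main.v *)
Require Import Defs.
From mathcomp Require Import boolp mpoly.
From mathcomp Require Import all_boot all_order all_algebra zify ring.

Set Implicit Arguments.
Unset Strict Implicit.
Unset Printing Implicit Defensive.

Import GRing.Theory.
Local Open Scope ring_scope.

(** Why the theorem holds.

    The computation of Tor is balanced: Tor_i(S/I, K)_j can be computed from the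
    Koszul complex of S/I instead of the given resolution [F].  The Koszul
    complex of S/I splits into strands indexed by multidegrees mu.  If some
    exponent of mu is at least two, the strand is a cone; if mu is the indicator
    of a vertex set W, the strand is the simplicial cochain complex of the
    independence complex Delta_W of the induced subgraph on W.  This is Hochster's
    formula in the form needed here ([betti_hochster]): for i > 0, beta_(i, i+j) is
    nonzero if and only if some W with i + j elements has nonzero reduced
    cohomology in the degree of the faces with j elements.  Call this condition
    [hnz j W], and let r_i be the largest j for which such a W exists, so that
    t_i = i + r_i.  One has to prove r_(a+4) <= r_a + r_4.

    The only topology used is the exact sequence relating Delta_W, the deletion
    of a vertex v and the link of v, which is the independence complex of the
    non-neighbours of v ([hnz_total], [hnz_link], [hnz_base]).  If [hnz j.+1 W]
    holds and fails after the deletion of any vertex, then a nonzero class of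
    the link of v survives, in degree j, on every set that lies between the link
    and the complement of an edge at v ([hnz_between]).  One may therefore
    delete v and m of its neighbours and find a class one degree lower
    ([critical_drop]).  With m = 1 this gives r_(i+1) <= r_i + 1.  With m = 2 it
    shows that r_(i+2) = r_i + 2 is only possible if the witness W is an induced
    matching ([two_steps_matching]).

    Suppose now that r_(a+4) > r_a + r_4, with a > 0.  An induced matching with
    three edges would force r_4 >= 3, because a further vertex adjacent to it,
    or a fourth edge, contributes to homological degree 4
    ([three_matching_strand]); then r grows at each of the four steps, the
    witness at a + 4 is a matching with at least four edges, and r_4 = 4, which
    is too much.  Hence there is no such matching, r never grows by two in two
    consecutive steps, and counting steps leaves only r_4 = 1 together with an
    index i in {a+3, a+4} where r_i = r_a + 2 is reached for the first time.
    The witness W at i has at least eight vertices and, by [critical_drop], all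
    its degrees are at most three.  The assumption r_4 = 1 says that no six
    vertices have [hnz 2] and no seven have [hnz 3].

    The last contradiction ([linear_strand_absurd]) comes from a smallest subset
    B of W with [hnz 2 B].  It has at least four elements.  Four elements form
    two disjoint edges; each vertex touching them is pinned down by the absence
    of [hnz 2] on six vertices, and the rest of W is too small.  Five elements
    cannot be touched from outside, so B and another edge have [hnz 3].  Six are
    excluded.  For seven or more, removing the ends of an edge leaves a set with
    disconnected independence complex, hence a spanning complete bipartite
    subgraph, which the degree bound does not leave room for. *)

(** * Cochains and cones *)

Section Cochains.
Variables (K : fieldType) (n : nat).
Implicit Types (A F U W Z : {set 'I_n}) (c b : {set 'I_n} -> K) (u v : 'I_n).

Definition sgn v A : K := (-1) ^+ #|[set u in A | (u < v)%N]|.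

Lemma sgnK v A : sgn v A * sgn v A = 1.
Proof. by rewrite -expr2 sqrr_sign. Qed.

Lemma sgn_setU1 u v A : v \notin A ->
  sgn u (v |: A) = (-1) ^+ (v < u)%N * sgn u A.
Proof.
move=> vA; rewrite /sgn -exprD; congr (_ ^+ _).
case: ltnP => vu.
  have -> : [set w in v |: A | (w < u)%N] = v |: [set w in A | (w < u)%N].
    by apply/setP=> w; rewrite !inE andb_orl; case: eqP => // ->; rewrite vu.
  by rewrite cardsU1 !inE (negbTE vA).
apply: eq_card => w; rewrite !inE andb_orl.
by case: eqP => //= ->; rewrite ltnNge vu (negbTE vA).
Qed.

Lemma sgn_self v A : v \notin A -> sgn v (v |: A) = sgn v A.
Proof. by move=> vA; rewrite sgn_setU1 // ltnn mul1r. Qed.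

Lemma sgn_swap u v A : u != v -> u \notin A -> v \notin A ->
  sgn u (v |: A) = - (sgn v (u |: A) * sgn u A * sgn v A).
Proof.
move=> uv uA vA; rewrite !sgn_setU1 //.
have -> : ((u < v)%N : bool) = ~~ (v < u)%N.
  by rewrite -leqNgt ltn_neqAle uv.
transitivity (- ((-1) ^+ (~~ (v < u)%N) * sgn u A * (sgn v A * sgn v A)) : K).
  by rewrite sgnK mulr1; case: (_ < _)%N; rewrite ?expr0 ?expr1 ?mulN1r ?opprK ?mul1r.
by ring.
Qed.

Definition cob c F : K := \sum_(v in F) sgn v F * c (F :\ v).

Lemma eq_cob c b F : (forall v, v \in F -> c (F :\ v) = b (F :\ v)) ->
  cob c F = cob b F.
Proof. by move=> cb; apply: eq_bigr => v vF; rewrite cb. Qed.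

Lemma cobB c b F : cob (fun A => c A - b A) F = cob c F - cob b F.
Proof. by rewrite /cob -sumrB; apply: eq_bigr => v _; rewrite mulrBr. Qed.

Lemma cob_eq0 c F : (forall v, v \in F -> c (F :\ v) = 0) -> cob c F = 0.
Proof. by move=> c0; rewrite /cob big1 // => v vF; rewrite c0 ?mulr0. Qed.

(** The part of a cochain on the faces through [v], seen as a cochain on the link
    of [v]; the sign makes the formula for its coboundary independent of the
    position of [v]. *)
Definition slice v c A : K := sgn v A * c (v |: A).

Lemma cob_setU1 v c F : v \notin F ->
  cob c (v |: F) = sgn v F * (c F - cob (slice v c) F).
Proof.
move=> vF; rewrite /cob big_setU1 //= setU1K // sgn_self // mulrBr; congr (_ + _).
rewrite mulr_sumr -sumrN; apply: eq_bigr => u uF.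
have uv : u != v by apply: contraNneq vF => <-.
have -> : (v |: F) :\ u = v |: (F :\ u).
  by apply/setP=> w; rewrite !inE; case: (eqVneq w v) => // ->; rewrite eq_sym uv.
have uA : u \notin F :\ u by rewrite !inE eqxx.
have vA : v \notin F :\ u by rewrite !inE (negbTE vF) andbF.
rewrite /slice -{1 3 4}(setD1K uF) setUCA (sgn_self (A := v |: (F :\ u))); last first.
  by rewrite !inE negb_or uv eqxx.
by rewrite sgn_swap // (sgn_self uA); ring.
Qed.

(** The complex is the mapping cone of the restriction from the deletion of [v] to
    the link of [v]; this is its differential on the link component. *)
Lemma slice_cob v c F : v \notin F -> slice v (cob c) F = c F - cob (slice v c) F.
Proof. by move=> vF; rewrite /slice cob_setU1 // mulrA sgnK mul1r. Qed.

(** Induction on the face: in the mapping cone the square of the differential is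
    that of the link, so no double sum has to be antisymmetrized. *)
Lemma cob_cob c F : cob (cob c) F = 0.
Proof.
have [m] := ubnP #|F|; elim: m => // m IH in c F *.
case: (set_0Vmem F) => [-> _|[v vF] Fm]; first by rewrite /cob big_set0.
have vF' : v \notin F :\ v by rewrite !inE eqxx.
rewrite -(setD1K vF) cob_setU1 // (@eq_cob (slice v (cob c))
  (fun A => c A - cob (slice v c) A)).
  rewrite cobB opprB addrC subrK IH ?mulr0 //.
  by move: Fm; rewrite (cardsD1 v) vF.
by move=> u uF; rewrite slice_cob // !inE eqxx andbF.
Qed.

(** Vanishing of one cohomology group of the cochains on the sets in [X].  The
    family [X] is arbitrary because the same notion serves for independence
    complexes and for all multigraded strands of the Koszul complex. *)
Definition vanishing (X : pred {set 'I_n}) (j : nat) : Prop :=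
  forall c, (forall F, X F -> #|F| = j.+1 -> cob c F = 0) ->
  exists b, forall F, X F -> #|F| = j -> c F = cob b F.

(** Slicing at the apex is a contracting homotopy of a cone. *)
Lemma vanishing_cone (X : pred {set 'I_n}) v j :
  (forall F, v \notin F -> X F -> X (v |: F)) -> vanishing X j.
Proof.
move=> coneX c c0; pose b F := if v \in F then 0 else slice v c F.
exists b => F XF Fj; case: (boolP (v \in F)) => vF; last first.
  transitivity (cob (slice v c) F); last first.
    by apply: eq_cob => u uF; rewrite /b !inE (negbTE vF) andbF.
  apply/eqP; rewrite -subr_eq0 -slice_cob // /slice c0 ?mulr0 //.
    exact: coneX.
  by rewrite cardsU1 vF Fj.
have vF' : v \notin F :\ v by rewrite !inE eqxx.
rewrite -[in RHS](setD1K vF) cob_setU1 // (@cob_eq0 (slice v b)); last first.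
  by move=> u uF; rewrite /slice /b !inE eqxx mulr0.
by rewrite subr0 /b (negbTE vF') /slice mulrA sgnK mul1r setD1K.
Qed.

End Cochains.

Section Glue.
Variables (K : fieldType) (n : nat) (v : 'I_n).
Implicit Types (A F : {set 'I_n}) (a b c : {set 'I_n} -> K).

(** The inverse of slicing: a cochain given by its values off [v] and its slice at
    [v]. *)
Definition glue a b F : K :=
  if v \in F then sgn K v (F :\ v) * b (F :\ v) else a F.

Lemma glue_notin a b F : v \notin F -> glue a b F = a F.
Proof. by rewrite /glue => /negbTE->. Qed.

Lemma slice_glue a b F : v \notin F -> slice v (glue a b) F = b F.
Proof. by move=> vF; rewrite /slice /glue setU11 setU1K // mulrA sgnK mul1r. Qed.

Lemma cob_glue_notin a b F : v \notin F -> cob (glue a b) F = cob a F.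
Proof. by move=> vF; apply: eq_cob => u _; rewrite glue_notin // !inE (negbTE vF) andbF. Qed.

Lemma slice_cob_glue a b F : v \notin F ->
  slice v (cob (glue a b)) F = a F - cob b F.
Proof.
move=> vF; rewrite slice_cob // glue_notin //; congr (_ - _).
by apply: eq_cob => u _; rewrite slice_glue // !inE (negbTE vF) andbF.
Qed.

Lemma slice_inj b c F : slice v b F = slice v c F -> b (v |: F) = c (v |: F).
Proof. by move=> /(mulfI _)-> //; rewrite /sgn signr_eq0. Qed.

Lemma slice_eq0 c F : slice v c F = 0 -> c (v |: F) = 0.
Proof. by move=> bc; apply: (@slice_inj c (fun=> 0)); rewrite bc /slice mulr0. Qed.

End Glue.

(** * The exact sequence of a vertex *)

Section IndependenceComplex.
Variables (K : fieldType) (n : nat) (e : rel 'I_n).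
Hypotheses (e_sym : symmetric e) (e_irr : irreflexive e).
Implicit Types (A B F L N O P Q S U W Z : {set 'I_n}) (u v w x y : 'I_n).

Definition nbh v : {set 'I_n} := [set u | e v u].

Definition indep F := [forall u in F, forall w in F, ~~ e u w].

Lemma indepP F : reflect {in F &, forall u w, ~~ e u w} (indep F).
Proof.
apply: (iffP forall_inP) => [iF u w uF wF|iF u uF]; first by have /forall_inP := iF u uF; apply.
by apply/forall_inP => w; apply: iF.
Qed.

Definition face W : pred {set 'I_n} := fun F => (F \subset W) && indep F.

Lemma face_notin v U F : v \notin F -> face (v |: U) F = face U F.
Proof.
by move=> vF; rewrite /face -subDset (setDidPl _) // disjoint_sym disjoints1.
Qed.

Lemma face_sub W W' F : W \subset W' -> face W F -> face W' F.
Proof. by move=> WW' /andP[FW iF]; rewrite /face (subset_trans FW). Qed.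

Lemma face_notin_base v U F : v \notin U -> face U F -> v \notin F.
Proof. by move=> vU /andP[/subsetP FU _]; apply: contra vU => /FU. Qed.

Lemma face_setU1 v U F : v \notin F ->
  face (v |: U) (v |: F) = face (U :\: nbh v) F.
Proof.
move=> vF; rewrite /face; apply/andP/andP=> [[/subsetP FU /indepP iF]|[/subsetP FU /indepP iF]].
  split.
    apply/subsetP => w wF; rewrite !inE.
    have := FU w; rewrite !inE wF orbT => /(_ isT).
    case: eqP => [wv|_ /= ->]; first by rewrite -wv wF in vF.
    by rewrite andbT iF ?setU11 // setU1r.
  by apply/indepP=> u w uF wF; apply: iF; rewrite setU1r.
split; first by apply/setUS/subsetP => w /FU /setDP[].
have vw w : w \in F -> ~~ e v w by move=> /FU; rewrite !inE => /andP[].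
apply/indepP => u w /setU1P[->|uF] /setU1P[->|wF]; rewrite ?e_irr ?vw //.
  by rewrite e_sym vw.
exact: iF.
Qed.

(** [hnz j W]: the reduced cohomology of the independence complex of the induced
    subgraph on [W] is nonzero in the degree of the faces with [j] elements. *)
Definition hnz (j : nat) W : Prop := ~ vanishing K (face W) j.

(** An isolated vertex is the apex of a cone. *)
Lemma hnz_cone j v W : v \in W -> nbh v :&: W = set0 -> ~ hnz j W.
Proof.
move=> vW v0; apply; apply: (@vanishing_cone _ _ _ v) => F vF FW.
have isolated : W :\ v :\: nbh v = W :\ v.
  apply/setP => w; move/setP/(_ w): v0; rewrite !inE.
  by case: (e v w) => //= ->; rewrite andbF.
by rewrite -(setD1K vW) face_setU1 // isolated -(face_notin _ vF) setD1K.
Qed.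

Section Triple.
Variables (v : 'I_n) (U : {set 'I_n}).
Hypothesis vU : v \notin U.

Lemma face_link F : face (U :\: nbh v) F -> face U F.
Proof. by apply: face_sub; exact: subsetDl. Qed.

Lemma face_add F : face (v |: U) F ->
  (v \notin F /\ face U F) \/
  (exists F', [/\ v \notin F', face (U :\: nbh v) F' & F = v |: F']).
Proof.
case: (boolP (v \in F)) => vF FW; [right|by left; rewrite face_notin in FW].
have vF' : v \notin F :\ v by rewrite !inE eqxx.
by exists (F :\ v); split; rewrite ?setD1K // -face_setU1 // setD1K.
Qed.

(** For W = v + U and L the set of non-neighbours of v in U, the long exact sequence
    reads H^(j-1)(L) -> H^j(W) -> H^j(U) -> H^j(L).  The next three lemmas are
    exactness at its three kinds of terms: a nonzero group has a nonzero neighbour.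
    Here a class of the total space vanishing on U comes from L. *)
Lemma hnz_total j : hnz j.+1 (v |: U) -> hnz j.+1 U \/ hnz j (U :\: nbh v).
Proof.
move=> hW; apply: contrapT => /not_orP[/contrapT vanU /contrapT vanL].
apply: hW => c c0.
have [|b cb] := vanU c.
  by move=> F FU; apply: c0; rewrite face_notin //; apply: face_notin_base FU.
have [|d cd] := vanL (slice v (fun F => c F - cob b F)).
  move=> F FL Fj; have FU := face_link FL; have vF := face_notin_base vU FU.
  have := slice_cob (fun F => c F - cob b F) vF; rewrite cb // subrr sub0r /slice => /eqP.
  rewrite cobB cob_cob subr0 c0 ?mulr0 ?face_setU1 ?cardsU1 ?vF ?Fj //.
  by rewrite eq_sym oppr_eq0 => /eqP.
exists (fun F => b F + glue v (fun=> 0) (fun F => - d F) F) => F FW Fj.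
rewrite -[RHS]opprK -[X in - X]add0r; apply/eqP; rewrite -subr_eq0.
have -> : cob (fun F => b F + glue v (fun=> 0) (fun F => - d F) F) F =
          cob b F + cob (glue v (fun=> 0) (fun F => - d F)) F.
  by rewrite /cob -big_split; apply: eq_bigr => u _; rewrite mulrDr.
rewrite add0r opprK opprD addrA.
case: (face_add FW) => [[vF FU]|[F' [vF' FL eF]]].
  by rewrite cb // subrr sub0r cob_glue_notin // cob_eq0 ?oppr0.
rewrite {}eF in Fj *; apply/eqP.
have {}Fj : #|F'| = j by move: Fj; rewrite cardsU1 vF' => -[].
pose f F := c F - cob b F - cob (glue v (fun=> 0) (fun F => - d F)) F.
apply: (@slice_eq0 _ _ v f); rewrite /f /slice mulrBr.
rewrite -[X in _ - X]/(slice v _ _) slice_cob_glue // sub0r.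
rewrite -[X in X - _]/(slice v (fun F => c F - cob b F) F') cd // opprK.
by rewrite /cob -big_split big1 //= => u _; rewrite mulrN addrN.
Qed.

(** If H^(j+1)(W) vanishes, every class of the link extends to U, and hence to each
    intermediate set T, where it remains nonzero as it is nonzero on the link. *)
Lemma hnz_link j (T : {set 'I_n}) : U :\: nbh v \subset T -> T \subset U ->
  hnz j (U :\: nbh v) -> hnz j T \/ hnz j.+1 (v |: U).
Proof.
move=> LT TU hL; apply: contrapT => /not_orP[/contrapT vanT /contrapT vanW].
apply: hL => c c0.
have [|b cb] := vanW (glue v (fun=> 0) c).
  move=> F /face_add[[vF FU] _|[F' [vF' FL ->]]].
    by rewrite cob_glue_notin // cob_eq0.
  rewrite cardsU1 vF' => -[Fj]; apply: slice_eq0.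
  by rewrite slice_cob_glue // sub0r c0 ?oppr0.
have [|d bd] := vanT b.
  move=> F /(face_sub TU) FU Fj; have vF := face_notin_base vU FU.
  by rewrite -cb ?glue_notin ?face_notin.
exists (fun F => d F - slice v b F) => F FL Fj.
have FU := face_link FL; have vF := face_notin_base vU FU.
rewrite cobB -bd ?(face_sub LT) // -slice_cob // -(slice_glue (fun=> 0) c vF).
by rewrite /slice cb // ?face_setU1 // cardsU1 vF Fj.
Qed.

(** A class of U that vanishes on the link extends to W. *)
Lemma hnz_base j : hnz j U -> hnz j (v |: U) \/ hnz j (U :\: nbh v).
Proof.
move=> hU; apply: contrapT => /not_orP[/contrapT vanW /contrapT vanL].
apply: hU => c c0.
have [|d cd] := vanL c; first by move=> F FL; apply/c0/face_link.
have [|b cb] := vanW (glue v c d).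
  move=> F /face_add[[vF FU] Fj|[F' [vF' FL ->]]].
    by rewrite cob_glue_notin // c0.
  rewrite cardsU1 vF' => -[Fj]; apply: slice_eq0.
  by rewrite slice_cob_glue // cd // subrr.
exists b => F FU Fj; have vF := face_notin_base vU FU.
by rewrite -cb ?glue_notin ?face_notin.
Qed.

End Triple.

Lemma hnz00 : hnz 0 set0.
Proof.
move=> van; have [|b bE] := van (fun=> 1).
  by move=> F /andP[+ _]; rewrite subset0 => /eqP->; rewrite cards0.
have := bE set0; rewrite cards0 /cob big_set0 => E.
suff /E/(_ erefl)/eqP : face set0 set0 by rewrite oner_eq0.
by rewrite /face subxx; apply/indepP => u; rewrite inE.
Qed.

Lemma hnz_set0 j : hnz j set0 -> j = 0%N.
Proof.
case: j => // j hj; exfalso; apply: hj => c c0; exists (fun=> 0) => F /andP[+ _] Fj.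
by rewrite subset0 => /eqP F0; rewrite F0 cards0 in Fj.
Qed.

(** A reduced zero-cocycle is a function that is constant along the edges of the
    independence complex, that is, along non-edges of the graph. *)
Lemma hnz1_nonconst U : hnz 1 U -> exists g : 'I_n -> K,
  (exists x y, [/\ x \in U, y \in U & g x != g y]) /\
  {in U &, forall x y, ~~ e x y -> g x = g y}.
Proof.
move=> hU; apply: contrapT => noG; apply: hU => c c0.
pose g v := c [set v].
have g_edge : {in U &, forall x y, ~~ e x y -> g x = g y}.
  move=> x y xU yU xy; have [->//|nxy] := eqVneq x y.
  have xNy : x \notin [set y] by rewrite inE.
  have : cob c (x |: [set y]) = 0.
    apply: c0; last by rewrite cardsU1 xNy cards1.
    rewrite /face; apply/andP; split; first by apply/subsetP => w /set2P[->|->].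
    by apply/indepP => u w /set2P[->|->] /set2P[->|->]; rewrite ?e_irr // e_sym.
  have E : [set y] :\ y = set0 :> {set 'I_n} by apply/setP => w; rewrite !inE; case: eqP.
  rewrite cob_setU1 // /cob big_set1 /slice E setU0.
  have s0 w : sgn K w set0 = 1.
    by rewrite /sgn (_ : [set _ in _ | _] = set0) ?cards0 //; apply/setP => z; rewrite !inE.
  rewrite !s0 mul1r.
  have -> : sgn K y [set y] = 1 by rewrite -[[set y]]setU0 sgn_self ?inE ?s0.
  rewrite mul1r => /eqP; rewrite mulf_eq0 /sgn signr_eq0 /= subr_eq0 => /eqP cy.
  by rewrite /g cy.
case: (set_0Vmem U) => [U0|[x xU]].
  exists (fun=> 0) => F /andP[+ _] Fj; rewrite U0 subset0 => /eqP F0.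
  by rewrite F0 cards0 in Fj.
exists (fun=> g x) => F /andP[FU _] /eqP/cards1P[y Fy].
rewrite Fy in FU *; rewrite sub1set in FU.
have -> : c [set y] = g x.
  apply: contrapT => /eqP nxy; apply: noG; exists g; split=> //.
  by exists y, x.
rewrite /cob big_set1 -[[set y]]setU0 sgn_self ?inE // /sgn.
rewrite (_ : [set _ in _ | _] = set0) ?cards0 ?mul1r //.
by apply/setP => z; rewrite !inE.
Qed.

End IndependenceComplex.

(** * Vertex-critical sets *)

Section EdgeIdealCombinatorics.
Local Open Scope nat_scope.
Variables (K : fieldType) (n : nat) (e : rel 'I_n).
Hypotheses (e_sym : symmetric e) (e_irr : irreflexive e).
Implicit Types (A B F L N O Q S U W Z : {set 'I_n}) (u v w x y : 'I_n).

Local Notation h := (hnz K e).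
Local Notation nb := (nbh e).

Lemma nbP v U : reflect (forall u, u \in U -> ~~ e v u) (nb v :&: U == set0).
Proof.
apply: (iffP eqP) => [E u uU|E].
  by apply/negP => evu; have := in_set0 u; rewrite -E !inE evu uU.
by apply/setP => u; rewrite !inE; apply/negP => /andP[evu /E]; rewrite evu.
Qed.

Lemma hnz_edge j W v : h j W -> v \in W -> exists2 u, u \in W & e v u.
Proof.
move=> hW vW; apply: contrapT => noE.
apply: (hnz_cone e_sym e_irr vW _ hW); apply/eqP/nbP => u uW.
by apply/negP => evu; apply: noE; exists u.
Qed.

Lemma edge_neq u v : e u v -> u != v.
Proof. by apply: contraTneq => ->; rewrite e_irr. Qed.

(** The independence complex of an edge is a pair of points, so a disjoint edge
    suspends the complex. *)
Lemma hnz_join_edge j S x y : e x y -> x \notin S -> y \notin S ->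
  (forall s, s \in S -> ~~ e x s /\ ~~ e y s) -> h j S -> h j.+1 (x |: (y |: S)).
Proof.
move=> exy xS yS Sxy hS.
have xyS : x \notin y |: S by rewrite !inE negb_or xS (edge_neq exy).
have L : (y |: S) :\: nb x = S.
  apply/setP => s; rewrite !inE; case: eqP => [->|_] /=; first by rewrite exy (negbTE yS).
  by case: (boolP (s \in S)) => [/Sxy[->]|]; rewrite ?andbF.
have hL : h j ((y |: S) :\: nb x) by rewrite L.
have [hyS|//] := hnz_link e_sym e_irr xyS (subsetDl _ _) (subxx _) hL.
exfalso; apply: (hnz_cone e_sym e_irr (setU11 y S) _ hyS); apply/eqP/nbP => s.
by case/setU1P=> [->|/Sxy[]//]; rewrite e_irr.
Qed.

(** Each step that lowers the degree passes to a link and loses a vertex together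
    with one of its neighbours. *)
Lemma hnz_card j W : h j W -> (2 * j <= #|W|)%N.
Proof.
have [m] := ubnP #|W|; elim: m => // m IH in j W *.
case: j => // j Wm hW.
case: (set_0Vmem W) => [W0|[v vW]]; first by move: hW; rewrite W0 => /hnz_set0.
have [u uW evu] := hnz_edge hW vW.
have vW' : v \notin W :\ v by rewrite !inE eqxx.
have Wc : #|W| = #|W :\ v|.+1 by rewrite (cardsD1 v) vW.
move: (hW); rewrite -(setD1K vW) => /(hnz_total e_sym e_irr vW')[]/IH; rewrite setD1K //; first lia.
have : (#|(W :\ v) :\: nb v| < #|W :\ v|)%N.
  apply/proper_card/properP; split; first exact: subsetDl.
  by exists u; rewrite !inE ?uW ?andbT ?evu // eq_sym edge_neq.
by lia.
Qed.

Lemma hnz0 W : h 0 W -> W = set0.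
Proof.
move=> hW; case: (set_0Vmem W) => // -[v vW]; exfalso; apply: hW => c c0.
exists (fun=> 0)%R => F _ /cards0_eq->; rewrite {1}/cob big_set0.
have vN : v \notin (set0 : {set 'I_n}) by rewrite inE.
have := @slice_cob K n v c set0 vN; rewrite /slice c0 ?GRing.mulr0 ?setU0 ?cards1 //.
  by rewrite /cob big_set0 GRing.subr0 => <-.
rewrite /face sub1set vW; apply/indepP => x y /set1P-> /set1P->.
by rewrite e_irr.
Qed.

(** Since [W :\ v] has no cohomology in degree [j.+1], the class on [W] comes from the
    link of [v]; since [W :\ u] has none either, all classes of the link extend to
    the complement of the edge [uv]. *)
Lemma hnz_between j W u v U : h j.+1 W -> u \in W -> v \in W -> e v u ->
  ~ h j.+1 (W :\ v) -> ~ h j.+1 (W :\ u) ->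
  (W :\ v) :\: nb v \subset U -> U \subset W :\ v :\ u -> h j U.
Proof.
move=> hW uW vW evu hv hu LU UW.
have vW' : v \notin W :\ v by rewrite !inE eqxx.
have vWu : v \notin W :\ v :\ u by rewrite !inE eqxx andbF.
move: (hW); rewrite -(setD1K vW) => /(hnz_total e_sym e_irr vW')[//|hL].
have E : (W :\ v :\ u) :\: nb v = (W :\ v) :\: nb v.
  by apply/setP => z; rewrite !inE; case: eqP => [->|_] //=; rewrite evu.
rewrite -E in hL LU; case: (hnz_link e_sym e_irr vWu LU UW hL) => // hWu; exfalso.
apply: hu; rewrite (_ : W :\ u = v |: (W :\ v :\ u)) //.
apply/setP => z; rewrite !inE; case: (eqVneq z v) => //= ->.
by rewrite vW (edge_neq evu).
Qed.

Lemma sub_of_card m A : (m <= #|A|)%N -> exists2 R : {set 'I_n}, R \subset A & #|R| = m.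
Proof.
move=> /card_geqP[s [us ss sA]]; exists [set z in s].
  by apply/subsetP => z; rewrite inE => /sA.
by rewrite cardsE -ss; apply/card_uniqP.
Qed.

Definition vertex_critical j W := h j W /\ forall v, v \in W -> ~ h j (W :\ v).

Definition deg W v := #|nb v :&: W|.

(** In [hnz_between] one may delete [v] and any nonempty set of its neighbours. *)
Lemma critical_drop j W v m : vertex_critical j.+1 W -> v \in W ->
  (0 < m <= deg W v)%N ->
  exists U, [/\ U \subset W, #|U| = (#|W| - m.+1)%N & h j U].
Proof.
move=> [hW cW] vW /andP[m0 /sub_of_card[R RN Rm]].
have RW z : z \in R -> [/\ z \in W, e v z & z != v].
  move=> /(subsetP RN); rewrite !inE => /andP[evz ->]; split=> //.
  by rewrite eq_sym edge_neq.
have [u uR] : exists u, u \in R by apply/card_gt0P; rewrite Rm.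
have [uW evu uv] := RW u uR.
exists (W :\ v :\: R); split.
- by rewrite setDDl subsetDl.
- rewrite cardsD (setIidPr _) ?Rm; first by have := cardsD1 v W; rewrite vW add1n => ->; rewrite subSS.
  by apply/subsetP => z /RW[zW _ zv]; rewrite !inE zv.
apply: (hnz_between hW uW vW evu); rewrite ?cW //; try exact: cW.
  apply/subsetP => z; rewrite !inE => /andP[nvz /andP[-> ->]]; rewrite !andbT.
  by apply: contra nvz => /RW[].
by apply/subsetP => z; rewrite !inE => /andP[zR ->]; rewrite andbT; apply: contra zR => /eqP->.
Qed.

Lemma deg_gt0 j W v : h j W -> v \in W -> (0 < deg W v)%N.
Proof.
move=> hW vW; have [u uW evu] := hnz_edge hW vW.
by apply/card_gt0P; exists u; rewrite !inE evu.
Qed.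


(** * Induced matchings *)

(** The vertex sets of induced matchings: the induced subgraph is one-regular. *)
Definition matching O := forall v, v \in O -> deg O v = 1%N.

Lemma matching_uniq O v x y : matching O -> v \in O -> x \in O -> y \in O ->
  e v x -> e v y -> x = y.
Proof.
move=> mO vO xO yO evx evy; have /eqP/cards1P[z E] := mO v vO.
have /set1P-> : x \in [set z] by rewrite -E !inE evx.
by apply/esym/set1P; rewrite -E !inE evy.
Qed.

Lemma matching_mate O v : matching O -> v \in O -> exists2 x, x \in O & e v x.
Proof.
move=> mO vO; have /eqP/cards1P[z E] := mO v vO.
by have := set11 z; rewrite -E !inE => /andP[]; exists z.
Qed.

Lemma matching_add O x y : matching O -> e x y ->
  (forall s, s \in O -> ~~ e x s /\ ~~ e y s) -> matching (x |: (y |: O)).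
Proof.
move=> mO exy Oxy v; rewrite /deg => /setU1P[->|/setU1P[->|vO]].
- rewrite (_ : _ :&: _ = [set y]) ?cards1 //; apply/setP => z; rewrite !inE.
  apply/andP/eqP => [[exz]|->]; last by rewrite exy eqxx orbT.
  case: (eqVneq z x) exz => [->|_ exz]; first by rewrite e_irr.
  by case: (eqVneq z y) => // _ /Oxy[]; rewrite exz.
- rewrite (_ : _ :&: _ = [set x]) ?cards1 //; apply/setP => z; rewrite !inE.
  apply/andP/eqP => [[eyz]|->]; last by rewrite e_sym exy eqxx.
  case: (eqVneq z y) eyz => [->|_ eyz]; first by rewrite e_irr.
  by case: (eqVneq z x) => // _ /Oxy[_]; rewrite eyz.
have [vx vy] := Oxy v vO; rewrite -(mO v vO) /deg; apply: eq_card => z.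
rewrite !inE; case: (eqVneq z x) => [->|_]; first by rewrite e_sym (negbTE vx).
by case: (eqVneq z y) => [->|//]; first by rewrite e_sym (negbTE vy).
Qed.

Lemma card_add_edge O x y : e x y ->
  (forall s, s \in O -> ~~ e x s /\ ~~ e y s) -> #|x |: (y |: O)| = #|O|.+2.
Proof.
move=> exy Oxy; have xO : x \notin O.
  by apply/negP => /Oxy[_]; rewrite e_sym exy.
have yO : y \notin O by apply/negP => /Oxy[]; rewrite exy.
by rewrite !cardsU1 !inE negb_or xO yO edge_neq.
Qed.

Lemma matching_split O : matching O -> O != set0 -> exists x y O',
  [/\ e x y, x \notin O', y \notin O', O = x |: (y |: O') &
    matching O' /\ forall s, s \in O' -> ~~ e x s /\ ~~ e y s].
Proof.
move=> mO /set0Pn[x xO]; have [y yO exy] := matching_mate mO xO.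
have eyx : e y x by rewrite e_sym.
have xy := edge_neq exy; exists x, y, (O :\ x :\ y).
have O'xy s : s \in O :\ x :\ y -> ~~ e x s /\ ~~ e y s.
  rewrite !inE => /and3P[sy sx sO]; split.
    by apply: contra sy => exs; apply/eqP/(matching_uniq mO xO).
  by apply: contra sx => eys; apply/eqP/(matching_uniq mO yO).
split=> //; rewrite ?inE ?eqxx ?andbF //.
  by rewrite setD1K ?setD1K // !inE eq_sym xy.
split=> // v vO'; have [] := O'xy v vO'; rewrite ![e _ v]e_sym => vx vy.
move: vO'; rewrite !inE => /and3P[_ _ vO]; rewrite -(mO v vO).
apply: eq_card => z; rewrite !inE; case: (eqVneq z x) => [->|_].
  by rewrite (negbTE vx).
by case: (eqVneq z y) => [->|//]; rewrite (negbTE vy).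
Qed.

Lemma card_setU2 x y O : x \notin O -> y \notin O -> x != y ->
  #|x |: (y |: O)| = #|O|.+2.
Proof. by move=> xO yO xy; rewrite !cardsU1 !inE negb_or xO xy yO. Qed.

Lemma matching_hnz m O : matching O -> #|O| = (2 * m)%N -> h m O.
Proof.
elim: m O => [|m IH] O mO; first by rewrite muln0 => /cards0_eq->; apply: hnz00.
move=> Om; have [|x [y [O' [exy xO' yO' E [mO' O'xy]]]]] := matching_split mO.
  by rewrite -card_gt0 Om.
rewrite E in Om *; apply: hnz_join_edge => //; apply: IH => //.
by move: Om; rewrite card_setU2 ?edge_neq //; lia.
Qed.

Lemma matching_sub m O : matching O -> (2 * m <= #|O|)%N ->
  exists O', [/\ O' \subset O, matching O' & #|O'| = (2 * m)%N].
Proof.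
elim: m O => [|m IH] O mO Om.
  exists set0; rewrite sub0set cards0; split=> // v; by rewrite inE.
have [|x [y [O1 [exy xO1 yO1 E [mO1 O1xy]]]]] := matching_split mO.
  by rewrite -card_gt0; lia.
have xy := edge_neq exy.
have [|O' [/subsetP sO' mO' O'm]] := IH O1 mO1.
  by move: Om; rewrite E card_setU2 //; lia.
exists (x |: (y |: O')); split.
- by rewrite E; apply/setUS/setUS/subsetP.
- by apply: matching_add => // s /sO'; apply: O1xy.
by rewrite card_setU2 ?O'm; [lia|apply: contra xO1; apply: sO'|apply: contra yO1; apply: sO'|].
Qed.

(** * Growth of the strand index *)

(** By Hochster's formula, the pairs for which beta_(i, i+j) is nonzero; see
    [betti_hochster] for i > 0. *)
Definition betti_support i j := exists2 W : {set 'I_n}, #|W| = (i + j)%N & h j W.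

Lemma betti_support0 i : betti_support i 0 -> i = 0%N.
Proof. by move=> [W + /hnz0 W0]; rewrite W0 cards0 addn0 => <-. Qed.

Lemma critical_of i j W : #|W| = (i.+1 + j)%N -> h j W ->
  ~ betti_support i j -> vertex_critical j W.
Proof.
move=> Wc hW nP; split=> // v vW hWv; apply: nP; exists (W :\ v) => //.
by move: Wc; rewrite (cardsD1 v) vW add1n addSn => -[].
Qed.

(** Either some vertex can be deleted, or the witness is critical and an edge can. *)
Lemma betti_support_step i j : betti_support i.+1 j -> betti_support i j \/ betti_support i j.-1.
Proof.
move=> PiS; have [|nP] := EM (betti_support i j); [by left|right].
have [W Wc hW] := PiS; case: j => [|j] in PiS nP Wc hW *; first by have := betti_support0 PiS.
have cW := critical_of Wc hW nP.
have [v vW] : exists v, v \in W by apply/card_gt0P; rewrite Wc.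
have [|U [_ Uc hU]] := critical_drop (m := 1) cW vW; first by rewrite /= (deg_gt0 hW).
exists U => //; rewrite Uc Wc; lia.
Qed.

(** A vertex of degree at least two could be deleted together with two neighbours,
    which gives a class in degree [j.+1] already at the homological index [i]. *)
Lemma two_steps_matching i j W : #|W| = (i.+2 + j.+2)%N -> h j.+2 W ->
  ~ betti_support i.+1 j.+2 -> ~ betti_support i j.+1 -> matching W.
Proof.
move=> Wc hW nP nP' v vW; have cW := critical_of Wc hW nP.
apply/eqP; rewrite eqn_leq (deg_gt0 hW vW) andbT leqNgt; apply/negP => d2.
have [|U [_ Uc hU]] := critical_drop (m := 2) cW vW; first by rewrite d2.
by apply: nP'; exists U => //; rewrite Uc Wc; lia.
Qed.

(** A matching with three edges lies in homological index 3.  A vertex adjacent to it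
    raises the index without killing its class, as the link of that vertex has too
    few vertices; if there is none, a vertex of [W] outside the matching has an edge
    disjoint from it. *)
Lemma three_matching_strand O j W : matching O -> #|O| = 6%N -> h j W ->
  (6 < #|W|)%N -> betti_support 4 3 \/ betti_support 4 4.
Proof.
move=> mO O6 hW W7; have hO : h 3 O by apply: matching_hnz.
case: (EM (exists2 w, w \notin O & exists2 x, x \in O & e w x)) => [[w wO [x xO ewx]]|noE].
  left; exists (w |: O); first by rewrite cardsU1 wO O6.
  have [//|/hnz_card] := hnz_base e_sym e_irr wO hO.
  have := subset_leq_card (_ : O :\: nb w \subset O :\ x); rewrite (cardsD1 x O) xO add1n in O6.
  move=> H; suff /H : O :\: nb w \subset O :\ x by lia.
  by apply/subsetP => z; rewrite !inE => /andP[nwz ->]; rewrite andbT; apply: contra nwz => /eqP->.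
have {}noE w x : w \notin O -> x \in O -> ~~ e w x.
  by move=> wO xO; apply/negP => ewx; apply: noE; exists w => //; exists x.
have [x xW xO] : exists2 x, x \in W & x \notin O.
  by apply/subsetPn; apply: contraTN W7 => /subset_leq_card; rewrite O6 -leqNgt.
have [y yW exy] := hnz_edge hW xW.
have yO : y \notin O by apply: contraTN exy => /noE; apply.
right; exists (x |: (y |: O)); first by rewrite card_setU2 ?edge_neq ?O6.
by apply: hnz_join_edge => // s sO; rewrite !noE.
Qed.


(** Three edges without further adjacencies are automatically disjoint. *)
Lemma three_edges_matching a a' b b' c c' :
  e a a' -> e b b' -> e c c' ->
  [&& ~~ e a b, ~~ e a b', ~~ e a' b & ~~ e a' b'] ->
  [&& ~~ e a c, ~~ e a c', ~~ e a' c & ~~ e a' c'] ->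
  [&& ~~ e b c, ~~ e b c', ~~ e b' c & ~~ e b' c'] ->
  exists2 O, matching O & #|O| = 6%N.
Proof.
move=> ea eb ec /and4P[ab ab' a'b a'b'] /and4P[ac ac' a'c a'c'] /and4P[bc bc' b'c b'c'].
have m0 : matching set0 by move=> z; rewrite inE.
have n1 s : s \in set0 -> ~~ e c s /\ ~~ e c' s by rewrite inE.
have m1 := matching_add m0 ec n1.
have n2 s : s \in c |: (c' |: set0) -> ~~ e b s /\ ~~ e b' s.
  by rewrite setU0 => /set2P[]->.
have m2 := matching_add m1 eb n2.
have n3 s : s \in b |: (b' |: (c |: (c' |: set0))) -> ~~ e a s /\ ~~ e a' s.
  by rewrite setU0 => /setU1P[->|/setU1P[->|/set2P[]->]].
exists (a |: (a' |: (b |: (b' |: (c |: (c' |: set0)))))).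
  exact: matching_add.
by rewrite !card_add_edge // cards0.
Qed.

(** * The case where homological degree four is linear *)

Section LinearStrand.
Variables (j : nat) (W : {set 'I_n}).
Hypotheses (cW : vertex_critical j W) (j3 : (3 <= j)%N) (W8 : (8 <= #|W|)%N).
Hypothesis W_deg : forall v, v \in W -> (deg W v <= 3)%N.
Hypothesis no_3K2 : forall O, matching O -> #|O| <> 6%N.
Hypothesis no_hnz2 : forall S, #|S| = 6%N -> ~ h 2 S.
Hypothesis no_hnz3 : forall S, #|S| = 7%N -> ~ h 3 S.

Let hW : h j W := proj1 cW.

Section TwoEdges.
Variable O : {set 'I_n}.
Hypotheses (OW : O \subset W) (mO : matching O) (O4 : #|O| = 4%N).

Let inW x : x \in O -> x \in W. Proof. exact: (subsetP OW). Qed.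

(** The set [t |: O] has a class in degree 2.  Adding [t'] would give six vertices
    with such a class unless it is killed, so the non-neighbours of [t'] in [t |: O]
    must carry a class as well; having at least four elements, they miss only [o'].
    The mate of [o'] is not isolated there, hence adjacent to [t]. *)
Lemma second_neighbour t t' o' : t \notin O -> t' \notin O -> t != t' ->
  (exists2 o, o \in O & e t o) -> o' \in O -> e t' o' ->
  [/\ ~~ e t t', forall z, z \in O -> e t' z -> z = o' &
    exists2 p, p \in O & e o' p /\ e t p].
Proof.
move=> tO t'O tt' [o oO eto] o'O et'o'.
have hO : h 2 O by apply: matching_hnz.
have hS : h 2 (t |: O).
  have [//|/hnz_card] := hnz_base e_sym e_irr tO hO.
  suff : (#|O :\: nb t| < #|O|)%N by rewrite O4 ltnS leqNgt => /negP.
  apply/proper_card/properP; split; first exact: subsetDl.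
  by exists o; rewrite // !inE eto.
have S5 : #|t |: O| = 5%N by rewrite cardsU1 tO O4.
have t'S : t' \notin t |: O by rewrite !inE negb_or eq_sym tt'.
case: (hnz_base e_sym e_irr t'S hS) => [h6|hS'].
  by case: (no_hnz2 _ h6); rewrite cardsU1 t'S S5.
have ES : (t |: O) :\: nb t' = (t |: O) :\ o'.
  apply/eqP; rewrite eqEcard; apply/andP; split.
    apply/subsetP => z; rewrite !inE => /andP[nz ->]; rewrite andbT.
    by apply: contra nz => /eqP->.
  have := hnz_card hS'; have := cardsD1 o' (t |: O).
  by rewrite !inE o'O orbT S5 add1n => -[<-].
have uniq z : z \in t |: O -> e t' z -> z = o'.
  move=> zS ez; apply/eqP; apply: contraT => zo'.
  have : z \in (t |: O) :\ o' by rewrite in_setD1 zo' zS.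
  by rewrite -ES inE inE ez.
have [p pO eo'p] := matching_mate mO o'O.
have pS : p \in (t |: O) :\ o' by rewrite !inE pO orbT eq_sym edge_neq.
split.
- apply: contraT; rewrite negbK e_sym => /(uniq t (setU11 _ _)) to'.
  by rewrite to' o'O in tO.
- by move=> z zO; apply: uniq; rewrite setU1r.
exists p => //; split=> //; rewrite ES in hS'.
have [z] := hnz_edge hS' pS; rewrite !inE => /andP[zo' /orP[/eqP-> epz|zO epz]].
  by rewrite e_sym.
case/eqP: zo'; apply: (matching_uniq mO pO) => //; by rewrite e_sym.
Qed.

Lemma neighbour_pair t t' o o' : t \notin O -> t' \notin O -> t != t' ->
  o \in O -> e t o -> o' \in O -> e t' o' ->
  [/\ ~~ e t t', e o o' & forall z, z \in O -> e t z -> z = o].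
Proof.
move=> tO t'O tt' oO eto o'O et'o'.
have [|ntt' _ [p pO [eo'p etp]]] := second_neighbour tO t'O tt' _ o'O et'o'; first by exists o.
have [||_ tu _] := second_neighbour t'O tO _ _ oO eto; rewrite 1?eq_sym //; first by exists o'.
by split=> //; rewrite e_sym -(tu p pO etp).
Qed.

Definition touches t := [&& t \in W, t \notin O & [exists o in O, e t o]].

Lemma untouched_edge x y : x \notin O -> y \notin O ->
  (forall o, o \in O -> ~~ e x o /\ ~~ e y o) -> ~~ e x y.
Proof.
move=> xO yO xyO; apply/negP => exy.
apply: (no_3K2 (matching_add mO exy xyO)).
by rewrite card_setU2 ?edge_neq ?O4.
Qed.

Lemma not_touches w : w \in W -> w \notin O -> ~~ touches w ->
  forall o, o \in O -> ~~ e w o.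
Proof.
by move=> wW wO; rewrite /touches wW wO /= => /exists_inPn.
Qed.

(** Otherwise [w] and its neighbour form a third edge of an induced matching. *)
Lemma rest_neighbour w : w \in W -> w \notin O -> ~~ touches w ->
  forall z, z \in W -> e w z -> touches z.
Proof.
move=> wW wO wT z zW ewz; apply: contraT => zT.
have wN := not_touches wW wO wT.
have zO : z \notin O by apply: contraTN ewz; apply: wN.
have zN := not_touches zW zO zT.
by move: ewz; apply: contraTT => _; apply: untouched_edge => // o oO; rewrite wN ?zN.
Qed.

Lemma touched : exists t, touches t.
Proof.
have [x xW xO] : exists2 x, x \in W & x \notin O.
  by apply/subsetPn; apply: contraTN W8 => /subset_leq_card; rewrite O4; lia.
case: (boolP (touches x)) => xT; first by exists x.
have [y yW exy] := hnz_edge hW xW.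
by exists y; apply: (rest_neighbour xW xO xT).
Qed.

Lemma two_outside (R : {set 'I_n}) : (#|R| <= 2)%N ->
  exists w w', [/\ w != w', w \in W, w' \in W, w \notin O :|: R & w' \notin O :|: R].
Proof.
move=> R2; have : (1 < #|W :\: (O :|: R)|)%N.
  have := cardsID (O :|: R) W; have := subset_leq_card (subsetIr W (O :|: R)).
  by have := cardsU O R; rewrite O4; lia.
move=> /card_gt1P[w [w' [+ + ww']]]; rewrite !in_setD => /andP[? ?] /andP[? ?].
by exists w, w'.
Qed.

(** With a single touching vertex [t], the remaining vertices are all pendant at [t].
    There are at least two of them, and the second becomes isolated in the link of the
    first. *)
Lemma touches_unique t : touches t -> (forall s, touches s -> s = t) -> False.
Proof.
move=> tT uT; have [|w [w' [ww' wW w'W]]] := two_outside (R := [set t]); first by rewrite cards1.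
rewrite !inE !negb_or => /andP[wO wt] /andP[w'O w't].
have wN z : z != t -> ~~ touches z by apply: contraNN => /uT->.
have only z : z \in W -> z \notin O -> z != t -> forall u, u \in W -> e z u -> u = t.
  by move=> zW zO zt u uW /(rest_neighbour zW zO (wN z zt) uW)/uT.
have [z zW ewz] := hnz_edge hW wW; have zt := only w wW wO wt z zW ewz.
rewrite {}zt in ewz zW.
have wW' : w \notin W :\ w by rewrite !inE eqxx.
move: cW j3; case: (j) => // i [hWi dW] i3.
move: (hWi); rewrite -(setD1K wW) => /(hnz_total e_sym e_irr wW')[/(dW w wW)//|hL].
have w'L : w' \in (W :\ w) :\: nb w.
  rewrite !inE eq_sym ww' w'W !andbT; apply: contra w't => /(only w wW wO wt)->//.
have [u] := hnz_edge hL w'L; rewrite !inE => /and3P[nwu _ uW] /(only w' w'W w'O w't u uW) ut.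
by rewrite ut ewz in nwu.
Qed.

(** If [w] were adjacent to [t] only, then [xx'], [wt] and [o't'] would form an induced
    matching. *)
Lemma rest_common t t' o o' x x' : touches t -> touches t' -> t != t' ->
  o \in O -> e t o -> o' \in O -> e t' o' -> x \in O -> x' \in O -> e x x' ->
  x \notin [set o; o'] -> x' \notin [set o; o'] ->
  forall w, w \in W -> w \notin O -> ~~ touches w -> e w t -> e w t'.
Proof.
move=> /and3P[tW tO _] /and3P[t'W t'O _] tt' oO eto o'O et'o' xO x'O exx' xo x'o w wW wO wT ewt.
have [ntt' eoo' tu] := neighbour_pair tO t'O tt' oO eto o'O et'o'.
have t't : t' != t by rewrite eq_sym.
have [_ _ t'u] := neighbour_pair t'O tO t't o'O et'o' oO eto.
have wN := not_touches wW wO wT.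
move: xo x'o; rewrite !inE !negb_or => /andP[xo xo'] /andP[x'o x'o'].
have oo' := edge_neq eoo'.
have tN z : z \in O -> z != o -> ~~ e t z by move=> zO; apply: contra => /tu->.
have t'N z : z \in O -> z != o' -> ~~ e t' z by move=> zO; apply: contra => /t'u->.
have o'N z : z \in O -> z != o -> ~~ e o' z.
  by move=> zO; apply: contra => eo'z; rewrite (matching_uniq mO o'O zO oO) // e_sym.
apply: contraT => nwt'.
have eo't' : e o' t' by rewrite e_sym.
have [|||O6 /no_3K2] // := three_edges_matching exx' ewt eo't'.
- by rewrite ![e _ w]e_sym ![e _ t]e_sym !wN // !tN.
- by rewrite ![e _ o']e_sym ![e _ t']e_sym !o'N // !t'N.
by rewrite nwt' wN // ntt' tN // eq_sym.
Qed.

(** Two touching vertices [t], [t'] are adjacent to the two ends of one edge [oo'], and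
    a third one is impossible.  The other vertices of [W] are adjacent to both [t]
    and [t'], so that [t] is the centre of a claw disjoint from the second edge
    [xx']; claw and edge have six vertices and a class in degree 2. *)
Lemma touches_two t t' : touches t -> touches t' -> t != t' -> False.
Proof.
move=> tT t'T tt'; have t't : t' != t by rewrite eq_sym.
have /and3P[tW tO /exists_inP[o oO eto]] := tT.
have /and3P[t'W t'O /exists_inP[o' o'O et'o']] := t'T.
have [ntt' eoo' tu] := neighbour_pair tO t'O tt' oO eto o'O et'o'.
have [_ _ t'u] := neighbour_pair t'O tO t't o'O et'o' oO eto.
have oo' := edge_neq eoo'.
have only s : touches s -> s \in [set t; t'].
  move=> /and3P[sW sO /exists_inP[q qO esq]]; rewrite !inE; apply: contraT.
  rewrite negb_or ![s == _]eq_sym => /andP[st st'].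
  have [_ eoq _] := neighbour_pair tO sO st oO eto qO esq.
  have [_ eo'q _] := neighbour_pair t'O sO st' o'O et'o' qO esq.
  by move: eo'q; rewrite -(matching_uniq mO oO o'O qO eoo' eoq) e_irr.
have [x xO] : exists2 x, x \in O & x \notin [set o; o'].
  by apply/subsetPn; apply/negP => /subset_leq_card; rewrite O4 cards2; case: eqP.
have [x' x'O exx'] := matching_mate mO xO.
have x'x : e x' x by rewrite e_sym.
move=> xoo'; have x'oo' : x' \notin [set o; o'].
  apply: contra xoo' => /set2P[] E; rewrite E in x'x; rewrite !inE.
    by rewrite (matching_uniq mO oO xO o'O) ?eqxx ?orbT.
  by rewrite (matching_uniq mO o'O xO oO) ?eqxx // e_sym.
have o'oE (z : 'I_n) : (z \notin [set o'; o]) = (z \notin [set o; o']) by rewrite setUC.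
have adj w : w \in W -> w \notin O -> ~~ touches w -> e w t.
  move=> wW wO wT; have [z zW ewz] := hnz_edge hW wW.
  have /only/set2P[zE|zE] := rest_neighbour wW wO wT zW ewz; rewrite zE // in ewz.
  by apply: (rest_common t'T tT t't o'O et'o' oO eto xO x'O exx' _ _ wW wO wT ewz); rewrite o'oE.
have [|w [w' [ww' wW w'W]]] := two_outside (R := [set t; t']); first by rewrite cards2 tt'.
rewrite !(in_setU _ O) !negb_or => /andP[wO wtt'] /andP[w'O w'tt'].
have wT : ~~ touches w by apply: contra wtt' => /only.
have w'T : ~~ touches w' by apply: contra w'tt' => /only.
have wN := not_touches wW wO wT; have w'N := not_touches w'W w'O w'T.
pose leaves : {set 'I_n} := [set o; w; w'].
have tleaf z : z \in leaves -> e t z.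
  by rewrite !inE -orbA => /or3P[]/eqP->; rewrite // e_sym adj.
have tl : t \notin leaves by apply/negP => /tleaf; rewrite e_irr.
have claw : h 1 (t |: leaves).
  have E : leaves :\: nb t = set0.
    apply/setP => z; rewrite in_setD in_set0 andbC; case: (boolP (z \in leaves)) => //= /tleaf etz.
    by rewrite inE etz.
  have hL : h 0 (leaves :\: nb t) by rewrite E; apply: hnz00.
  have [/hnz0 l0|//] := hnz_link e_sym e_irr tl (subsetDl _ _) (subxx _) hL.
  by have := in_set0 o; rewrite -l0 !inE eqxx.
move: xoo' x'oo'; rewrite !inE !negb_or => /andP[xo xo'] /andP[x'o x'o'].
have far s : s \in t |: leaves -> ~~ e x s /\ ~~ e x' s.
  have oN z : z \in O -> z != o' -> ~~ e z o.
    by move=> zO; apply: contra => ezo; apply/eqP/(matching_uniq mO oO) => //; rewrite e_sym.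
  case/setU1P=> [->|].
    by rewrite ![e _ t]e_sym; split; [apply: contra xo|apply: contra x'o] => /tu->.
  rewrite !inE -orbA => /or3P[]/eqP->; first by rewrite !oN.
    by rewrite ![e _ w]e_sym !wN.
  by rewrite ![e _ w']e_sym !w'N.
apply: (no_hnz2 _ (hnz_join_edge exx' _ _ far claw)); last 2 first.
- by apply/negP => /far[_]; rewrite x'x.
- by apply/negP => /far[]; rewrite exx'.
rewrite card_add_edge // cardsU1 tl /leaves -setUA cardsU1 cards2 ww' !inE.
have wo : o != w by apply: contraNneq wO => <-.
have w'o : o != w' by apply: contraNneq w'O => <-.
by rewrite negb_or wo w'o.
Qed.

Lemma no_two_edges : False.
Proof.
have [t tT] := touched; apply: (touches_unique tT) => s sT.
by apply/eqP; apply: contraT => st; case: (touches_two sT tT st).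
Qed.

End TwoEdges.

Lemma ex_hnz2 (i : nat) S : h i.+2 S -> exists2 B : {set 'I_n}, B \subset S & h 2 B.
Proof.
have [m] := ubnP #|S|; elim: m => // m IH in i S * => Sm hS.
case: i hS => [|i] hS; first by exists S.
have [v vS] : exists v, v \in S.
  by apply/card_gt0P; have := hnz_card hS; case: #|S|.
have vS' : v \notin S :\ v by rewrite !inE eqxx.
have Sc : (#|S :\ v| < m)%N by move: Sm; rewrite (cardsD1 v) vS.
move: hS; rewrite -(setD1K vS) => /(hnz_total e_sym e_irr vS')[hS|hS].
  have [B BS hB] := IH _ _ Sc hS; exists B => //.
  by apply: subset_trans BS _; rewrite setD1K // subD1set.
have [|B BS hB] := IH _ _ _ hS.
  by apply: leq_ltn_trans Sc; apply: subset_leq_card; apply: subsetDl.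
exists B => //; apply: subset_trans BS _; rewrite setD1K //.
by apply: subset_trans (subsetDl _ _) (subD1set _ _).
Qed.

(** The set [B] is a smallest induced subgraph with a class in degree 2: two disjoint
    edges, or the complement of a longer cycle. *)
Section SmallestCycle.
Variable B : {set 'I_n}.
Hypotheses (BW : B \subset W) (hB : h 2 B).
Hypothesis B_min : forall S, S \subset W -> h 2 S -> (#|B| <= #|S|)%N.

Let inW x : x \in B -> x \in W. Proof. exact: (subsetP BW). Qed.

Lemma smallest_critical : vertex_critical 2 B.
Proof.
split=> // v vB /B_min; rewrite (cardsD1 v B) vB ltnn => H.
by have := H (subset_trans (subD1set _ _) BW).
Qed.

(** By criticality, four vertices form two disjoint edges. *)
Lemma smallest_not4 : #|B| <> 4%N.
Proof.
move=> B4; apply: (no_two_edges BW) => // v vB.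
apply/eqP; rewrite eqn_leq (deg_gt0 hB vB) andbT leqNgt; apply/negP => d2.
have [|U [_ Uc /hnz_card]] := critical_drop (m := 2) smallest_critical vB; first by rewrite d2.
by rewrite Uc B4.
Qed.

(** A vertex adjacent to [B] would have too small a link to kill the class of [B], and
    six vertices would have a class in degree 2.  So an edge outside [B] is disjoint
    from it and suspends its class. *)
Lemma smallest_not5 : #|B| <> 5%N.
Proof.
move=> B5.
have far w b : w \in W -> w \notin B -> b \in B -> ~~ e w b.
  move=> wW wB bB; apply/negP => ewb.
  case: (hnz_base e_sym e_irr wB hB) => [h6|hL].
    by apply: (no_hnz2 _ h6); rewrite cardsU1 wB B5.
  have := B_min (subset_trans (subsetDl _ _) BW) hL; apply/negP; rewrite -ltnNge.
  apply/proper_card/properP; split; first exact: subsetDl.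
  by exists b; rewrite // !inE ewb.
have [x xW xB] : exists2 x, x \in W & x \notin B.
  by apply/subsetPn; apply: contraTN W8 => /subset_leq_card; rewrite B5; lia.
have [y yW exy] := hnz_edge hW xW.
have yB : y \notin B by apply: contraTN exy; apply: far.
have xyB s : s \in B -> ~~ e x s /\ ~~ e y s by move=> sB; rewrite !far.
apply: (no_hnz3 _ (hnz_join_edge exy xB yB xyB hB)).
by rewrite card_add_edge ?B5.
Qed.

(** The complement of an edge of [B] has a disconnected independence complex. *)
Lemma smallest_between u v : u \in B -> v \in B -> e v u -> h 1 (B :\ v :\ u).
Proof.
move=> uB vB evu; have [_ cB] := smallest_critical.
apply: (hnz_between hB uB vB evu (cB v vB) (cB u uB)) => //.
by apply/subsetP => z; rewrite !inE => /andP[nvz ->]; rewrite andbT; apply: contra nvz => /eqP->.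
Qed.

(** [P1] and [Q] are the two sides of a spanning complete bipartite subgraph of the
    complement of the edge [uv]. *)
Section CompleteBipartite.
Variables (u v : 'I_n) (P1 Q : {set 'I_n}).
Hypotheses (uB : u \in B) (vB : v \in B) (euv : e u v) (B7 : (7 <= #|B|)%N).
Hypothesis PQ_eq : P1 :|: Q = B :\ u :\ v.
Hypothesis PQ : forall p q, p \in P1 -> q \in Q -> e p q.
Hypotheses (P2 : (2 <= #|P1|)%N) (Q3 : #|Q| = 3%N).

Let inP p : p \in P1 -> [/\ p \in W, p != u & p != v].
Proof.
move=> pP; have : p \in P1 :|: Q by rewrite inE pP.
by rewrite PQ_eq !inE => /and3P[-> -> /inW ->].
Qed.

Let inQ p : p \in Q -> [/\ p \in W, p != u & p != v].
Proof.
move=> pP; have : p \in P1 :|: Q by rewrite inE pP orbT.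
by rewrite PQ_eq !inE => /and3P[-> -> /inW ->].
Qed.

(** The three edges to [Q] exhaust the degree of [p]. *)
Lemma nb_left p : p \in P1 -> nb p :&: W = Q.
Proof.
move=> pP; apply/eqP; rewrite eq_sym eqEcard Q3 W_deg ?andbT; last by case: (inP pP).
by apply/subsetP => q qQ; rewrite !inE PQ //; case: (inQ qQ).
Qed.

Lemma left_far p z : p \in P1 -> z \in W -> z \notin Q -> ~~ e p z.
Proof. by move=> pP zW; apply: contra => epz; rewrite -(nb_left pP) !inE epz. Qed.

Let uQ : u \notin Q. Proof. by apply/negP => /inQ[_]; rewrite eqxx. Qed.
Let vQ : v \notin Q. Proof. by apply/negP => /inQ[_ _]; rewrite eqxx. Qed.

(** Otherwise [uv] and [pq] would be two disjoint edges inside [B]. *)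
Lemma right_adj q : q \in Q -> e q u || e q v.
Proof.
move=> qQ; have [p pP] : exists p, p \in P1 by apply/card_gt0P; apply: leq_trans P2.
apply: contraT; rewrite negb_or => /andP[qu qv].
have pu := left_far pP (inW uB) uQ; have pv := left_far pP (inW vB) vQ.
have far s : s \in u |: (v |: set0) -> ~~ e p s /\ ~~ e q s.
  by rewrite setU0 => /set2P[]->.
have huv : h 1 (u |: (v |: set0)).
  by apply: hnz_join_edge; rewrite ?inE //; [move=> s; rewrite inE|apply: hnz00].
have epq := PQ pP qQ.
have pN : p \notin u |: (v |: set0) by apply/negP => /far[_]; rewrite e_sym epq.
have qN : q \notin u |: (v |: set0) by apply/negP => /far[]; rewrite epq.
have h4 := hnz_join_edge epq pN qN far huv.
have /B_min/(_ h4) : p |: (q |: (u |: (v |: set0))) \subset W.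
  rewrite setU0; apply/subsetP => z.
  have [[pW _ _] [qW _ _]] := (inP pP, inQ qQ).
  by case/setU1P=> [->|/setU1P[->|/set2P[]->]] //; apply: inW.
rewrite (card_add_edge epq far) card_add_edge ?cards0 //.
  by rewrite leqNgt (leq_trans _ B7).
by move=> s; rewrite inE.
Qed.

(** The degree bound leaves [q] a single neighbour outside [P1]. *)
Lemma right_saturated q : q \in Q ->
  (e q u -> ~~ e q v) /\ (forall q', q' \in Q -> ~~ e q q').
Proof.
move=> qQ; have [qW qu qv] := inQ qQ.
have sat (R : {set 'I_n}) : [disjoint P1 & R] -> (1 < #|R|)%N -> R \subset nb q :&: W -> False.
  move=> PR R2 RN; have : P1 :|: R \subset nb q :&: W.
    rewrite subUset RN andbT; apply/subsetP => p pP; rewrite !inE e_sym PQ //.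
    by case: (inP pP).
  move=> /subset_leq_card/leq_trans/(_ (W_deg qW)).
  by rewrite cardsU (disjoint_setI0 PR) cards0 subn0 => /(leq_trans (leq_add P2 R2)).
have Pu : u \notin P1 by apply/negP => /inP[_]; rewrite eqxx.
have Pv : v \notin P1 by apply/negP => /inP[_ _]; rewrite eqxx.
have disj a b : a \notin P1 -> b \notin P1 -> [disjoint P1 & [set a; b]].
  by move=> aP bP; rewrite disjoint_sym disjoints_subset; apply/subsetP => z /set2P[]->; rewrite inE.
split.
  move=> equ; apply/negP => eqv; apply: (sat [set u; v]); rewrite ?disj //.
    by rewrite cards2 (edge_neq euv).
  by apply/subsetP => z /set2P[]->; rewrite !inE ?equ ?eqv inW.
move=> q' q'Q; apply/negP => eqq'; have [q'W q'u q'v] := inQ q'Q.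
have q'P : q' \notin P1 by apply/negP => q'P; have := PQ q'P q'Q; rewrite e_irr.
have /orP[eqz|eqz] := right_adj qQ.
  apply: (sat [set u; q']); rewrite ?disj // ?cards2 1?eq_sym ?q'u //.
  by apply/subsetP => z /set2P[]->; rewrite !inE ?eqz ?eqq' ?q'W ?inW.
apply: (sat [set v; q']); rewrite ?disj // ?cards2 1?eq_sym ?q'v //.
by apply/subsetP => z /set2P[]->; rewrite !inE ?eqz ?eqq' ?q'W ?inW.
Qed.

(** Apply [smallest_between] to the edge [v q2]: every remaining vertex is joined by
    non-edges to [u], some of them through [q3], so the independence complex of the
    complement is connected. *)
Lemma right_two q2 q3 : q2 \in Q -> q3 \in Q -> q2 != q3 ->
  ~~ e q2 u -> ~~ e q3 u -> False.
Proof.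
move=> q2Q q3Q q23 q2u q3u.
have evq2 : e v q2 by have := right_adj q2Q; rewrite (negbTE q2u) e_sym.
have [q2W q2u' q2v] := inQ q2Q; have [q3W q3u' q3v] := inQ q3Q.
have inB z : z \in Q -> z \in B.
  by move=> zQ; have : z \in P1 :|: Q by [rewrite inE zQ orbT]; rewrite PQ_eq !inE => /and3P[_ _].
have inB' z : z \in P1 -> z \in B.
  by move=> zQ; have : z \in P1 :|: Q by [rewrite inE zQ]; rewrite PQ_eq !inE => /and3P[_ _].
have [g [[x [y [xS yS gxy]]] gE]] := hnz1_nonconst e_sym e_irr (smallest_between (inB _ q2Q) vB evq2).
have uS : u \in B :\ v :\ q2 by rewrite !inE uB (edge_neq euv) eq_sym q2u'.
have q3S : q3 \in B :\ v :\ q2 by rewrite !inE inB // q3v eq_sym q23.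
suff gu z : z \in B :\ v :\ q2 -> g z = g u by rewrite (gu x xS) (gu y yS) eqxx in gxy.
move=> zS; have [->//|zu] := eqVneq z u.
have : z \in P1 :|: Q.
  by move: zS; rewrite PQ_eq !inE zu => /and3P[_ -> ->].
case/setUP=> [zP|zQ]; first by apply: gE => //; apply: left_far (inW uB) uQ.
case: (boolP (e z u)) => ezu; last exact: gE.
rewrite (gE z q3) //; first by apply: gE.
by have [_ ->] := right_saturated zQ.
Qed.

End CompleteBipartite.

(** Among the three vertices of [Q] two are not adjacent to the same end of [uv]. *)
Lemma no_bipartite u v (P1 Q : {set 'I_n}) : u \in B -> v \in B -> e u v ->
  (7 <= #|B|)%N -> P1 :|: Q = B :\ u :\ v ->
  (forall p q, p \in P1 -> q \in Q -> e p q) -> (2 <= #|P1|)%N -> #|Q| = 3%N -> False.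
Proof.
move=> uB vB euv B7 PQ_eq PQ P2 Q3.
have evu : e v u by rewrite e_sym.
have PQ_eq' : P1 :|: Q = B :\ v :\ u by rewrite PQ_eq; apply/setP => z; rewrite !inE andbCA.
have : (1 < #|Q :\: nb u|)%N \/ (1 < #|Q :&: nb u|)%N by have := cardsID (nb u) Q; lia.
case=> /card_gt1P[q2 [q3 []]]; rewrite !inE => /andP[q2H q2Q] /andP[q3H q3Q] q23.
  apply: (right_two uB vB euv B7 PQ_eq PQ P2 Q3 q2Q q3Q q23); by rewrite e_sym.
have nv q : q \in Q -> e u q -> ~~ e q v.
  by move=> qQ euq; have [H _] := right_saturated uB vB euv B7 PQ_eq PQ P2 Q3 qQ; apply: H; rewrite e_sym.
exact: (right_two vB uB evu B7 PQ_eq' PQ P2 Q3 q2H q3H q23 (nv _ q2H q2Q) (nv _ q3H q3Q)).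
Qed.

(** A vertex where [g] takes the value [g x] and one where it does not are adjacent,
    so the two level sets have at most three elements each and at least five
    together. *)
Lemma smallest_not_large : ~ (7 <= #|B|)%N.
Proof.
move=> B7; have [u uB] : exists u, u \in B by apply/card_gt0P; apply: leq_trans B7.
have [v vB euv] := hnz_edge hB uB; have evu : e v u by rewrite e_sym.
have [g [[x [y [xS yS gxy]]] gE]] := hnz1_nonconst e_sym e_irr (smallest_between vB uB euv).
set U := B :\ u :\ v in xS yS gE.
pose P1 := [set z in U | g z == g x]; pose Q := [set z in U | g z != g x].
have UE : P1 :|: Q = U.
  by apply/setP => z; rewrite !inE -andb_orr orbN andbT.
have UE' : Q :|: P1 = U by rewrite setUC.
have PQ p q : p \in P1 -> q \in Q -> e p q.
  rewrite [p \in _]inE [q \in _]inE => /andP[pU /eqP gp] /andP[qU gq].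
  by apply: contraT => /gE-/(_ pU qU) gpq; rewrite -gpq gp eqxx in gq.
have QP p q : p \in Q -> q \in P1 -> e p q by move=> pQ qP; rewrite e_sym PQ.
have UW z : z \in U -> z \in W by rewrite !inE => /and3P[_ _ /inW].
have PW z : z \in P1 -> z \in W by rewrite inE => /andP[/UW].
have QW z : z \in Q -> z \in W by rewrite inE => /andP[/UW].
have xP : x \in P1 by rewrite inE xS eqxx.
have yQ : y \in Q by rewrite inE yS eq_sym.
have Q3 : (#|Q| <= 3)%N.
  apply: leq_trans (W_deg (PW x xP)); apply: subset_leq_card; apply/subsetP => q qQ.
  by rewrite !inE PQ ?QW.
have P3 : (#|P1| <= 3)%N.
  apply: leq_trans (W_deg (QW y yQ)); apply: subset_leq_card; apply/subsetP => q qQ.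
  by rewrite !inE QP ?PW.
have UC : (#|B| <= #|P1| + #|Q| + 2)%N.
  have U2 : #|B| = #|U|.+2.
    have vu : v != u by rewrite edge_neq.
    by rewrite (cardsD1 u B) uB (cardsD1 v (B :\ u)) !inE vB vu.
  by rewrite U2 -UE cardsU addn2 !ltnS leq_subr.
have [Q3'|Q3'] := eqVneq #|Q| 3%N.
  apply: (no_bipartite uB vB euv B7 UE PQ _ Q3').
  by move: (leq_trans B7 UC); rewrite Q3'; clear; lia.
have Q2 : (#|Q| <= 2)%N by rewrite -ltnS ltn_neqAle Q3' Q3.
apply: (no_bipartite uB vB euv B7 UE' QP); move: (leq_trans B7 UC) P3 Q2; clear; lia.
Qed.

End SmallestCycle.

Lemma linear_strand_absurd : False.
Proof.
have jE : j = (j - 2).+2 by lia.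
have [B0 B0W hB0] : exists2 B : {set 'I_n}, B \subset W & h 2 B.
  by move: hW; rewrite jE => /ex_hnz2.
pose p (S : {set 'I_n}) := `[< S \subset W /\ h 2 S >].
have pB0 : p B0 by apply/asboolP.
case: (arg_minnP (fun S => #|S|) pB0) => B /asboolP[BW hB] B_min.
have {}B_min S : S \subset W -> h 2 S -> (#|B| <= #|S|)%N.
  by move=> SW hS; apply: B_min; apply/asboolP.
have := smallest_not4 BW hB B_min; have := smallest_not5 BW hB B_min.
have := smallest_not_large BW hB B_min; have := no_hnz2 (S := B); have := hnz_card hB.
move=> B4 n6 n7 n5 n4; apply: n6 => //; lia.
Qed.

End LinearStrand.

(** * Subadditivity of the strand index *)

(** The number r_i, with value 0 when homological degree [i] does not occur. *)
Definition top_strand i := \max_(j < n.+1 | `[< betti_support i j >]) j.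

Lemma top_strand_max i j : betti_support i j -> (j <= top_strand i)%N.
Proof.
move=> Pij; have jn : (j < n.+1)%N.
  by have [W Wc _] := Pij; have := max_card (mem W); rewrite Wc card_ord; lia.
by apply: (bigmax_sup (Ordinal jn)) => //; apply/asboolP.
Qed.

Lemma top_strandP i j : betti_support i j -> betti_support i (top_strand i).
Proof.
move=> Pij; have jn : (j < n.+1)%N.
  by have [W Wc _] := Pij; have := max_card (mem W); rewrite Wc card_ord; lia.
have [|k /asboolP Pk kE] := @eq_bigmax_cond _ [pred k : 'I_n.+1 | `[< betti_support i k >]] (fun k => k).
  by apply/card_gt0P; exists (Ordinal jn); apply/asboolP.
by rewrite /top_strand kE.
Qed.

Theorem subadditivity a j : (0 < a)%N -> betti_support (a + 4) j ->
  exists j' s, [/\ betti_support a j', betti_support 4 s & (j <= j' + s)%N].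
Proof.
move=> a0 Paj; have down i : betti_support i.+1 (top_strand i.+1) -> betti_support i (top_strand i).
  by case/betti_support_step; apply: top_strandP.
have top_step i : betti_support i.+1 (top_strand i.+1) -> (top_strand i.+1 <= (top_strand i).+1)%N.
  by case/betti_support_step => /top_strand_max; lia.
have P4 : betti_support (a + 4) (top_strand (a + 4)) by apply: top_strandP Paj.
rewrite !addnS addn0 in P4.
have P3 := down _ P4; have P2 := down _ P3; have P1 := down _ P2; have Pa := down _ P1.
have low i m : betti_support (i + m) (top_strand (i + m)) -> betti_support i (top_strand i).
  by elim: m i => [|m IH] i; rewrite ?addn0 // addnS => /down/IH.
have Ps : betti_support 4 (top_strand 4) by apply: (low 4 a); rewrite addnC !addnS addn0.
exists (top_strand a), (top_strand 4); split=> //; rewrite leqNgt; apply/negP => lt.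
have {lt} lt : (top_strand a + top_strand 4 < top_strand a.+4)%N.
  by apply: leq_trans lt _; have := top_strand_max Paj; rewrite !addnS addn0.
have s1 := top_step _ P1; have s2 := top_step _ P2.
have s3 := top_step _ P3; have s4 := top_step _ P4.
have top0 i : betti_support i.+1 (top_strand i.+1) -> (0 < top_strand i.+1)%N.
  by case: (top_strand i.+1) => // /betti_support0.
have r4 := top0 _ Ps; have ra : (0 < top_strand a)%N by move: Pa; case: (a) a0 => // i _; apply: top0.
have notP i k : (top_strand i < k)%N -> ~ betti_support i k by move=> lk /top_strand_max; lia.
have [W Wc hW] := P4.
have W7 : (6 < #|W|)%N by lia.
have two i : (a <= i)%N -> betti_support i.+2 (top_strand i.+2) ->
   top_strand i.+2 = (top_strand i).+2 ->
   exists O, [/\ matching O & (#|O| = i.+2 + top_strand i.+2)%N].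
  move=> ai Pi E; have [V Vc hV] := Pi; exists V; split=> //.
  have Pi1 := down _ Pi; have s := top_step _ Pi1.
  by rewrite E in Vc hV; apply: (two_steps_matching Vc hV); apply: notP; lia.
(* Three disjoint edges make r grow at every step, and then four disjoint edges
   give r_4 = 4. *)
have no_3K2 O : matching O -> #|O| <> 6%N.
  move=> mO O6; have top4 : (2 < top_strand 4)%N.
    by case: (three_matching_strand mO O6 hW W7) => /top_strand_max; lia.
  have [||V [mV Vc]] := two a.+2 _ P4; [lia|lia|].
  have [|V' [_ mV' V'8]] := matching_sub (m := 4) mV; first by rewrite Vc; lia.
  have : betti_support 4 4 by exists V' => //; apply: matching_hnz.
  by move=> /top_strand_max; lia.
have no_two i : (a <= i)%N -> betti_support i.+2 (top_strand i.+2) ->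
   top_strand i.+2 <> (top_strand i).+2.
  move=> ai Pi E; have [V [mV Vc]] := two i ai Pi E.
  have ti : (0 < top_strand i)%N.
    by have := down _ (down _ Pi); case: (i) (leq_trans a0 ai) => // k _; apply: top0.
  have [|V' [_ mV' V'6]] := matching_sub (m := 3) mV; first by rewrite Vc E; lia.
  exact: (no_3K2 V').
have t1 := no_two a (leqnn _) P2; have t2 := no_two a.+1 (leqnSn _) P3.
have t3 := no_two a.+2 (leq_trans (leqnSn _) (leqnSn _)) P4.
(* The four increments of r are at most one, no two consecutive ones are both one,
   and their sum exceeds r_4 > 0. *)
have top4 : top_strand 4 = 1%N by lia.
(* The index (a + m).+1 is the one where r_a + 2 is reached. *)
have absurd m : (1 < m < 4)%N -> betti_support (a + m).+1 (top_strand (a + m).+1) ->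
    top_strand (a + m).+1 = (top_strand a).+2 -> top_strand (a + m) = (top_strand a).+1 -> False.
  move=> /andP[m2 m4] [V Vc hV] E1 E0; have nP : ~ betti_support (a + m) (top_strand (a + m).+1).
    by apply: notP; lia.
  have cV := critical_of Vc hV nP; rewrite E1 in Vc cV.
  have i4 : (a + m).+1 != 4%N by apply: contra_eqN top4 => /eqP<-; rewrite E1.
  have V_le := hnz_card (proj1 cV).
  apply: (linear_strand_absurd cV) => //.
  - by move: i4; rewrite Vc; lia.
  - move=> v vV; rewrite leqNgt; apply/negP => d4.
    have [|U [_ Uc hU]] := critical_drop (m := m.+1) cV vV.
      by rewrite /= (leq_trans _ d4).
    suff /top_strand_max : betti_support a (top_strand a).+1 by rewrite ltnn.
    by exists U => //; rewrite Uc Vc; lia.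
  - move=> S S6 hS; have /top_strand_max : betti_support 4 2 by exists S.
    by rewrite top4.
  move=> S S7 hS; have /top_strand_max : betti_support 4 3 by exists S.
  by rewrite top4.
have [E|E] : (top_strand a.+3 = (top_strand a).+2 /\ top_strand a.+2 = (top_strand a).+1) \/
   (top_strand a.+4 = (top_strand a).+2 /\ top_strand a.+3 = (top_strand a).+1) by lia.
  by apply: (absurd 2) => //; rewrite !addnS addn0; case: E.
by apply: (absurd 3) => //; rewrite !addnS addn0; case: E.
Qed.

End EdgeIdealCombinatorics.

(** * Balancing a double complex *)

(** Exactness of the graded pieces singled out by [hA] and [hB]; carrying predicates
    avoids forming the graded pieces as groups of their own. *)
Definition exact_at (A B C : zmodType) (f : A -> B) (g : B -> C)
    (hA : A -> Prop) (hB : B -> Prop) : Prop :=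
  forall y, hB y -> g y = 0 -> exists2 x, hA x & f x = y.

Lemma morphB_D (A B : zmodType) (f : A -> B) :
  {morph f : x y / x - y} -> {morph f : x y / x + y}.
Proof.
move=> fB x y; have f0 : f 0 = 0 by rewrite -(subrr (0 : A)) fB subrr.
by rewrite -[y in LHS]opprK fB -[- y]sub0r fB f0 sub0r opprK.
Qed.

(** A first-quadrant double complex with commuting differentials [dcv] and [dch],
    whose rows and columns are resolutions, augmented to [dcM] and [dcN]. *)
Record double_complex := DoubleComplex {
  dcD : nat -> nat -> zmodType; dcM : nat -> zmodType; dcN : nat -> zmodType;
  dcv : forall p q, dcD p.+1 q -> dcD p q;
  dch : forall p q, dcD p q.+1 -> dcD p q;
  dce : forall q, dcD 0 q -> dcM q;
  dct : forall p, dcD p 0 -> dcN p;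
  dcm : forall q, dcM q.+1 -> dcM q;
  dcn : forall p, dcN p.+1 -> dcN p;
  homD : forall p q, dcD p q -> Prop;
  homM : forall q, dcM q -> Prop;
  homN : forall p, dcN p -> Prop;
  homB : forall p q x y, homD (x : dcD p q) -> homD y -> homD (x - y);
  dcvB : forall p q, {morph @dcv p q : x y / x - y};
  dchB : forall p q, {morph @dch p q : x y / x - y};
  dceB : forall q, {morph @dce q : x y / x - y};
  dctB : forall p, {morph @dct p : x y / x - y};
  homv : forall p q x, homD x -> homD (@dcv p q x);
  homh : forall p q x, homD x -> homD (@dch p q x);
  home : forall q x, homD x -> homM (@dce q x);
  homt : forall p x, homD x -> homN (@dct p x);
  dcvh : forall p q (x : dcD p.+1 q.+1), dcv (dch x) = dch (dcv x);
  dceh : forall q x, dce (@dch 0 q x) = dcm (dce x);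
  dctv : forall p x, dct (@dcv p 0 x) = dcn (dct x);
  dcvv : forall p q x, @dcv p q (dcv x) = 0;
  dchh : forall p q x, @dch p q (dch x) = 0;
  dcev : forall q x, dce (@dcv 0 q x) = 0;
  dcth : forall p x, dct (@dch p 0 x) = 0;
  exact_v : forall p q, exact_at (@dcv p.+1 q) (@dcv p q) (@homD _ _) (@homD _ _);
  exact_h : forall p q, exact_at (@dch p q.+1) (@dch p q) (@homD _ _) (@homD _ _);
  exact_e : forall q, exact_at (@dcv 0 q) (@dce q) (@homD _ _) (@homD _ _);
  exact_t : forall p, exact_at (@dch p 0) (@dct p) (@homD _ _) (@homD _ _);
  surj_e : forall q y, homM y -> exists2 x, homD x & @dce q x = y;
  surj_t : forall p y, homN y -> exists2 x, homD x & @dct p x = y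
}.

Definition transpose (B : double_complex) : double_complex :=
  @DoubleComplex (fun p q => dcD B q p) (dcN B) (dcM B)
    (fun p q => @dch B q p) (fun p q => @dcv B q p) (@dct B) (@dce B)
    (@dcn B) (@dcm B)
    (fun p q => @homD B q p) (@homN B) (@homM B)
    (fun p q => @homB B q p)
    (fun p q => @dchB B q p) (fun p q => @dcvB B q p) (@dctB B) (@dceB B)
    (fun p q => @homh B q p) (fun p q => @homv B q p) (@homt B) (@home B)
    (fun p q x => esym (@dcvh B q p x)) (@dctv B) (@dceh B)
    (fun p q => @dchh B q p) (fun p q => @dcvv B q p) (@dcth B) (@dcev B)
    (fun p q => @exact_h B q p) (fun p q => @exact_v B q p) (@exact_t B) (@exact_e B)
    (@surj_t B) (@surj_e B).

Section Balance.
Variable B : double_complex.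

Definition exactM q := exact_at (@dcm B q.+1) (@dcm B q) (@homM B _) (@homM B _).
Definition exactN p := exact_at (@dcn B p.+1) (@dcn B p) (@homN B _) (@homN B _).

(** The staircase: descend along the vertical direction to the augmentation, use
    exactness there, and climb back. *)
Lemma staircase i : exactM i -> forall p q (z : dcD B p q.+1) (y : dcD B p.+1 q),
  (p + q = i)%N -> homD z -> homD y -> dch z = dcv y ->
  exists w w', [/\ homD w, homD w' & z = dch w + dcv w'].
Proof.
move=> exM; elim=> [|p IH] q z y pqi hz hy dzy.
  rewrite add0n in pqi; subst i.
  have [||m hm mE] := exM (dce z); first exact: home.
    by rewrite -dceh dzy dcev.
  have [w hw wE] := surj_e hm.
  have [||w' hw' w'E] := @exact_e B q.+1 (z - dch w).
  - by apply: homB => //; apply: homh.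
  - by rewrite dceB dceh wE mE subrr.
  by exists w, w'; rewrite w'E addrC subrK.
have [||z' hz' z'E] := @exact_h B p q (dcv z); first exact: homv.
  by rewrite -dcvh dzy dcvv.
have pqi' : (p + q.+1 = i)%N by rewrite -pqi addnS.
have [w [w' [hw hw' wE]]] := IH q.+1 z' z pqi' hz' hz z'E.
have [||w2 hw2 w2E] := @exact_v B p q.+1 (z - dch w').
- by apply: homB => //; apply: homh.
- by rewrite dcvB -z'E wE (morphB_D (@dchB B _ _)) dchh add0r dcvh subrr.
by exists w', w2; rewrite w2E addrC subrK.
Qed.

Lemma balance i : exactM i -> exactN i.
Proof.
move=> exM x hx dx0.
have [z hz zE] := surj_t hx.
have [||z' hz' z'E] := @exact_t B i (dcv z); first exact: homv.
  by rewrite dctv zE dx0.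
have [w [w' [hw hw' wE]]] := staircase exM (addn0 i) hz' hz z'E.
have [||w2 hw2 w2E] := @exact_v B i 0 (z - dch w').
- by apply: homB => //; apply: homh.
- by rewrite dcvB -z'E wE (morphB_D (@dchB B _ _)) dchh add0r dcvh subrr.
exists (dct w2); first exact: homt.
by rewrite -dctv w2E dctB dcth subr0.
Qed.

End Balance.

(** The hypotheses are symmetric in the two directions. *)
Lemma balance_iff (B : double_complex) i : exactM B i <-> exactN B i.
Proof. by split; [apply: balance|apply: (@balance (transpose B))]. Qed.

(** * The Koszul complex, one multidegree at a time *)

Section KoszulStrand.
Variables (K : fieldType) (n : nat).
Implicit Types (A F Z : {set 'I_n}) (phi psi : {set 'I_n} -> K) (v : 'I_n).

(** The Koszul differential in a multidegree with support [Z], on coefficients: the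
    exterior factor of a term is [A], and the monomial factor is determined by it. *)
Definition kosZ Z phi A : K := \sum_(v in Z :\: A) sgn K v A * phi (v |: A).

Lemma eq_kosZ Z phi psi A : (forall v, v \in Z :\: A -> phi (v |: A) = psi (v |: A)) ->
  kosZ Z phi A = kosZ Z psi A.
Proof. by move=> E; apply: eq_bigr => v vZ; rewrite E. Qed.

(** Koszul chains are indexed by the exterior factor, simplicial cochains by the
    support of the monomial factor, which is its complement in [Z] when the
    multidegree is squarefree; this sign makes complementation a chain map. *)
Definition dual_sign Z F : K := \prod_(v in F) sgn K v Z.

Lemma dual_signK Z F : dual_sign Z F * dual_sign Z F = 1.
Proof. by rewrite /dual_sign -big_split big1 //= => v _; rewrite sgnK. Qed.

Definition dualize Z phi F : K := dual_sign Z F * phi (Z :\: F).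

Lemma sgnD v A Z : A \subset Z -> sgn K v (Z :\: A) * sgn K v Z = sgn K v A.
Proof.
move=> AZ; rewrite /sgn -exprD.
have -> : #|[set u in Z | (u < v)%N]| =
    (#|[set u in Z :\: A | (u < v)%N]| + #|[set u in A | (u < v)%N]|)%N.
  rewrite -(cardsID A [set u in Z | _]) addnC; congr (_ + _)%N; apply: eq_card => u.
    by rewrite !inE andbA.
  rewrite !inE andbAC; case: (boolP (u \in A)) => [/(subsetP AZ)->|]; rewrite ?andbF ?andbT //.
by rewrite addnA exprD addnn -mul2n exprM sqrrN expr1n expr1n mul1r.
Qed.

Lemma kosZ_cob Z phi A : A \subset Z ->
  kosZ Z phi A = dual_sign Z (Z :\: A) * cob (dualize Z phi) (Z :\: A).
Proof.
move=> AZ; rewrite /cob mulr_sumr; apply: eq_bigr => v vZA.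
have vA : v \notin A by move: vZA; rewrite inE => /andP[].
have E : Z :\: ((Z :\: A) :\ v) = v |: A.
  apply/setP => u; rewrite !inE; case: (eqVneq u v) => [->|uv] /=.
    by move: vZA; rewrite inE => /andP[_ ->].
  by case: (boolP (u \in A)) => [/(subsetP AZ)->//|] /=; case: (u \in Z).
rewrite /dualize E -(sgnD v AZ) [dual_sign Z (Z :\: A)](big_setD1 v) //=.
rewrite -/(dual_sign Z _); set d := dual_sign _ _.
transitivity ((d * d) * (sgn K v (Z :\: A) * sgn K v Z * phi (v |: A))).
  by rewrite dual_signK mul1r.
by ring.
Qed.

Lemma dualize_kosZ Z phi F : F \subset Z -> dualize Z (kosZ Z phi) F = cob (dualize Z phi) F.
Proof.
move=> FZ; rewrite /dualize kosZ_cob ?subsetDl // setDDr setDv set0U (setIidPr FZ).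
by rewrite mulrA dual_signK mul1r.
Qed.

Lemma kosZ_kosZ Z phi A : A \subset Z -> kosZ Z (kosZ Z phi) A = 0.
Proof.
move=> AZ; rewrite kosZ_cob // (@eq_cob _ _ _ (cob (dualize Z phi))) ?cob_cob ?mulr0 //.
by move=> v vZ; rewrite dualize_kosZ // (subset_trans (subD1set _ _)) ?subsetDl.
Qed.

(** Exactness of a strand whose terms are the exterior factors in [G]. *)
Definition strand_exact Z (G : pred {set 'I_n}) q : Prop :=
  forall phi, (forall A, A \subset Z -> G A -> #|A|.+1 = q -> kosZ Z phi A = 0) ->
  exists psi, forall A, A \subset Z -> G A -> #|A| = q -> phi A = kosZ Z psi A.

Definition dual_family Z (G : pred {set 'I_n}) : pred {set 'I_n} :=
  fun F => (F \subset Z) && G (Z :\: F).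

Lemma setDDK A Z : A \subset Z -> Z :\: (Z :\: A) = A.
Proof. by move=> AZ; rewrite setDDr setDv set0U (setIidPr AZ). Qed.

Lemma dualize_dual Z F (b : {set 'I_n} -> K) : F \subset Z ->
  dualize Z (fun A => dual_sign Z (Z :\: A) * b (Z :\: A)) F = b F.
Proof. by move=> FZ; rewrite /dualize setDDK // mulrA dual_signK mul1r. Qed.

Lemma vanishing_strand Z G q : vanishing K (dual_family Z G) (#|Z| - q) ->
  strand_exact Z G q.
Proof.
move=> van phi phi0.
have [qZ|Zq] := leqP q #|Z|; last first.
  by exists phi => A /subset_leq_card AZ _ Aq; move: AZ; rewrite Aq leqNgt Zq.
have [|b bE] := van (dualize Z phi).
  move=> F /andP[FZ GF] Fq; rewrite -dualize_kosZ // /dualize phi0 ?mulr0 ?subsetDl //.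
  by rewrite cardsD (setIidPr FZ) Fq; have := subset_leq_card FZ; lia.
exists (fun A => dual_sign Z (Z :\: A) * b (Z :\: A)) => A AZ GA Aq.
have -> : phi A = dual_sign Z (Z :\: A) * dualize Z phi (Z :\: A).
  by rewrite /dualize setDDK // mulrA dual_signK mul1r.
rewrite kosZ_cob // bE ?/dual_family ?subsetDl ?setDDK //; last first.
  by rewrite cardsD (setIidPr AZ) Aq.
congr (_ * _); apply: eq_cob => v vZ; rewrite dualize_dual //.
by rewrite (subset_trans (subD1set _ _)) ?subsetDl.
Qed.

Lemma strand_vanishing Z G q : (q <= #|Z|)%N -> strand_exact Z G q ->
  vanishing K (dual_family Z G) (#|Z| - q).
Proof.
move=> qZ ex c c0.
pose phi A := dual_sign Z (Z :\: A) * c (Z :\: A).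
have dc F : F \subset Z -> dualize Z phi F = c F by apply: dualize_dual.
have cE A : A \subset Z -> cob (dualize Z phi) (Z :\: A) = cob c (Z :\: A).
  by move=> AZ; apply: eq_cob => v _; rewrite dc // (subset_trans (subD1set _ _)) ?subsetDl.
have [|psi psiE] := ex phi.
  move=> A AZ GA Aq; rewrite kosZ_cob // cE // c0 ?mulr0 //.
    by rewrite /dual_family subsetDl setDDK.
  by rewrite cardsD (setIidPr AZ); have := subset_leq_card AZ; lia.
exists (dualize Z psi) => F /andP[FZ GF] Fq.
rewrite -dualize_kosZ // -dc // /dualize psiE ?subsetDl //.
by rewrite cardsD (setIidPr FZ) Fq; lia.
Qed.

End KoszulStrand.

(** * Koszul complexes of monomial quotients *)

Section Restriction.
Variables (K : fieldType) (n : nat).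
Implicit Types (p q : {mpoly K[n]}) (m : 'X_{1..n}) (X Y : pred 'X_{1..n}).

Lemma mcoeff_sumX (r : seq 'X_{1..n}) (c : 'X_{1..n} -> K) m : uniq r ->
  (\sum_(m' <- r) c m' *: 'X_[m'])@_m = if m \in r then c m else 0.
Proof.
move=> ur; rewrite raddf_sum /=; case: ifP => mr; last first.
  rewrite big1_seq // => m' /= m'r; rewrite mcoeffZ mcoeffX.
  by case: eqVneq m'r => [->|_ _]; rewrite ?mr ?mulr0.
rewrite (bigD1_seq m) //= mcoeffZ mcoeffX eqxx mulr1 big1 ?addr0 // => m' nm.
by rewrite mcoeffZ mcoeffX (negbTE nm) mulr0.
Qed.

(** Projection onto the span of the monomials in [X]; it serves both for normal forms
    modulo a monomial ideal and for homogeneous components. *)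
Definition mrestr X p : {mpoly K[n]} :=
  \sum_(m <- [seq m <- msupp p | X m]) p@_m *: 'X_[m].

Lemma mcoeff_restr X p m : (mrestr X p)@_m = if X m then p@_m else 0.
Proof.
rewrite mcoeff_sumX ?filter_uniq ?msupp_uniq // mem_filter.
by case: (X m) => //=; rewrite mcoeff_msupp; case: eqP => //= ->.
Qed.

Lemma mrestrB X : {morph mrestr X : p q / p - q}.
Proof.
move=> p q; apply/mpolyP => m; rewrite mcoeffB !mcoeff_restr mcoeffB.
by case: (X m); rewrite ?subr0.
Qed.

Lemma mrestr_sum X (I : finType) (P : pred I) (F : I -> {mpoly K[n]}) :
  mrestr X (\sum_(i | P i) F i) = \sum_(i | P i) mrestr X (F i).
Proof.
apply/mpolyP => m; rewrite mcoeff_restr !raddf_sum /=.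
case: ifP => Xm; last by rewrite big1 // => i _; rewrite mcoeff_restr Xm.
by apply: eq_bigr => i _; rewrite mcoeff_restr Xm.
Qed.

Lemma mrestr_id X p : {in msupp p, forall m, X m} -> mrestr X p = p.
Proof.
move=> pX; apply/mpolyP => m; rewrite mcoeff_restr; case: ifP => // Xm.
by apply/esym/memN_msupp_eq0/negP => /pX; rewrite Xm.
Qed.

(** Multiplication by [q] commutes with the projections when it carries the monomials
    in [Y], and no others, to monomials in [X]. *)
Lemma mrestrM X Y p q :
  (forall m m', m' \in msupp q -> X (m + m')%MM = Y m) ->
  mrestr X (p * q) = mrestr Y p * q.
Proof.
move=> XY; apply/mpolyP => m; rewrite mcoeff_restr !mcoeffM.
transitivity (\sum_(k : 'X_{1..n < (mdeg m).+1, (mdeg m).+1} | m == (k.1 + k.2)%MM)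
    if X m then p@_k.1 * q@_k.2 else 0); first by case: (X m); rewrite // big1.
apply: eq_bigr => k /eqP mE; rewrite mcoeff_restr (congr1 X mE).
have [q0|qk] := boolP ((k.2 : 'X_{1..n}) \in msupp q).
  by rewrite XY //; case: (Y _); rewrite ?mul0r.
by rewrite (memN_msupp_eq0 qk) !mulr0; case: (X _).
Qed.

Lemma mcoeff_mulU v p m :
  ('X_v * p)@_m = if (0 < m v)%N then p@_(m - U_(v)) else 0.
Proof.
rewrite mulrC; case: ifP => mv.
  have {1}-> : m = (U_(v) + (m - U_(v)))%MM.
    by rewrite addmC submK //; apply/mnm_lepP => i; rewrite mnm1E; case: eqP => // <-.
  by rewrite mcoeffMX.
apply: memN_msupp_eq0; rewrite (perm_mem (msuppMX _ _)); apply/negP => /mapP[m' _ E].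
by move: mv; rewrite E mnmDE mnm1E eqxx.
Qed.

End Restriction.

Section Koszul.
Variables (K : fieldType) (n : nat).
Implicit Types (A B F Z : {set 'I_n}) (v : 'I_n) (m mu : 'X_{1..n}).
Implicit Types (f g : {set 'I_n} -> {mpoly K[n]}).

(** The exponent of the squarefree monomial with support [A]. *)
Definition ind A : 'X_{1..n} := [multinom (i \in A : nat) | i < n].
Definition msup m : {set 'I_n} := [set v | (0 < m v)%N].

Lemma indE A v : ind A v = (v \in A). Proof. by rewrite mnmE. Qed.

Lemma ind_le A mu : A \subset msup mu -> (ind A <= mu)%MM.
Proof.
move=> /subsetP Amu; apply/mnm_lepP => v; rewrite indE.
by case: (boolP (v \in A)) => // /Amu; rewrite inE.
Qed.

Lemma subindK A mu : A \subset msup mu -> (mu - ind A + ind A)%MM = mu.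
Proof. by move=> /ind_le/submK. Qed.

Lemma mdeg_ind A : mdeg (ind A) = #|A|.
Proof.
rewrite mdegE (eq_bigr (fun i => (i \in A : nat))) => [|i _]; last exact: indE.
by rewrite -big_mkcond sum1_card.
Qed.

Lemma msup_add m A : msup (m + ind A)%MM :\: A = msup m :\: A.
Proof.
by apply/setP => v; rewrite !inE mnmDE indE; case: (v \in A); rewrite //= addn0.
Qed.

Lemma sub_msup_add m A : A \subset msup (m + ind A).
Proof. by apply/subsetP => v vA; rewrite inE mnmDE indE vA addn1. Qed.

Definition kos f A : {mpoly K[n]} :=
  \sum_(v | v \notin A) sgn K v A *: ('X_v * f (v |: A)).

(** The component of a Koszul chain in the multidegree [mu]. *)
Definition strand f mu A : K := (f A)@_(mu - ind A).

Lemma kos_coeff f A m :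
  (kos f A)@_m = kosZ (msup (m + ind A)) (strand f (m + ind A)) A.
Proof.
rewrite /kosZ msup_add raddf_sum /= big_mkcond [RHS]big_mkcond /=.
apply: eq_bigr => v _; rewrite !inE; case: (boolP (v \in A)) => //= vA.
rewrite mcoeffZ mcoeff_mulU; case: ifP => mv; last by rewrite mulr0.
congr (_ * _@_ _); apply/mnmP => i; rewrite !mnmBE mnmDE !indE mnm1E !inE eq_sym.
by case: (eqVneq i v) => [->|_] /=; rewrite ?(negbTE vA) ?addn0 ?addnK ?subn0.
Qed.

Lemma kos_strand f A mu : A \subset msup mu ->
  (kos f A)@_(mu - ind A) = kosZ (msup mu) (strand f mu) A.
Proof. by move=> Amu; rewrite kos_coeff subindK. Qed.

Lemma kos_kos f A : kos (kos f) A = 0.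
Proof.
apply/mpolyP => m; rewrite kos_coeff mcoeff0; set mu := (m + ind A)%MM.
have Amu : A \subset msup mu by apply: sub_msup_add.
rewrite -[RHS](kosZ_kosZ (strand f mu) Amu); apply: eq_kosZ => v vZ.
apply: kos_strand; rewrite subUset Amu sub1set andbT.
by move: vZ; rewrite inE => /andP[].
Qed.

Lemma kosB f g A : kos (fun B => f B - g B) A = kos f A - kos g A.
Proof. by rewrite /kos -sumrB; apply: eq_bigr => v _; rewrite mulrBr scalerBr. Qed.

Lemma eq_kos f g A : f =1 g -> kos f A = kos g A.
Proof. by move=> fg; apply: eq_bigr => v _; rewrite fg. Qed.

(** Koszul [q]-chains of internal degree [j] with coefficients in the span of the
    monomials in [X], on a generator of degree [s].  An exterior factor contributes
    its size to the degree. *)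
Definition homogeneous (X : pred 'X_{1..n}) j s q f : Prop :=
  forall A m, m \in msupp (f A) -> [/\ #|A| = q, (mdeg m + q + s = j)%N & X m].

Definition divisor_closed (X : pred 'X_{1..n}) : Prop :=
  forall m m', (m' <= m)%MM -> X m -> X m'.

Lemma restr_cycle X f mu A : mrestr X (kos f A) = 0 -> A \subset msup mu ->
  X (mu - ind A)%MM -> kosZ (msup mu) (strand f mu) A = 0.
Proof.
by move=> /(congr1 (mcoeff (mu - ind A)%MM)) + Amu XA; rewrite mcoeff_restr XA kos_strand // mcoeff0.
Qed.

(** The Koszul differential preserves the multidegree and a chain of fixed degree
    has finitely many multidegrees, so solutions of the strands assemble to a
    solution in polynomials. *)
Lemma kos_lift X j s q f : divisor_closed X -> homogeneous X j s q f ->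
  (forall mu, (mdeg mu + s = j)%N -> exists psi, forall A, A \subset msup mu ->
     X (mu - ind A)%MM -> #|A| = q -> strand f mu A = kosZ (msup mu) psi A) ->
  exists g : {ffun {set 'I_n} -> {mpoly K[n]}},
    homogeneous X j s q.+1 g /\ forall A, mrestr X (kos g A) = f A.
Proof.
move=> Xdiv hf sol.
have /choice[Psi PsiE] : forall mu, exists psi, (mdeg mu + s = j)%N ->
    forall A, A \subset msup mu -> X (mu - ind A)%MM -> #|A| = q ->
    strand f mu A = kosZ (msup mu) psi A.
  move=> mu; have [/sol[psi psiE]|nj] := eqVneq (mdeg mu + s)%N j; first by exists psi.
  by exists (fun=> 0) => /eqP; rewrite (negbTE nj).
pose c B m := if [&& #|B| == q.+1, (mdeg m + q.+1 + s == j)%N & X m]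
              then Psi (m + ind B)%MM B else 0.
pose g : {ffun {set 'I_n} -> {mpoly K[n]}} :=
  [ffun B => \sum_(m : 'X_{1..n < j.+1}) c B m *: 'X_[m]].
have gE B m : (g B)@_m = c B m.
  rewrite ffunE; have [mj|mj] := leqP (mdeg m) j; first by rewrite mcoeff_mpoly.
  rewrite /c ifF; last by apply/negbTE/negP => /and3P[_ /eqP E _]; lia.
  rewrite raddf_sum big1 // => k _; rewrite /= mcoeffZ mcoeffX.
  have [E|_] := eqVneq (k : 'X_{1..n}) m; last by rewrite mulr0.
  by have := bmdeg k; rewrite E; lia.
exists g; split.
  move=> B m; rewrite mcoeff_msupp gE /c; case: ifP; last by rewrite eqxx.
  by move=> /and3P[/eqP-> /eqP E Xm] _; split.
move=> A; apply/mpolyP => m; rewrite mcoeff_restr.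
case: ifP => Xm; last first.
  apply/esym/memN_msupp_eq0/negP => /hf[_ _].
  by rewrite Xm.
rewrite kos_coeff; set mu := (m + ind A)%MM.
have Amu : A \subset msup mu by apply: sub_msup_add.
have mE : (mu - ind A)%MM = m by rewrite addmK.
have BE v : v \in msup mu :\: A -> (v |: A \subset msup mu) && (#|v |: A| == #|A|.+1).
  rewrite inE => /andP[vA vmu]; rewrite subUset sub1set vmu Amu /=.
  by rewrite cardsU1 vA.
have strandE v : v \in msup mu :\: A -> strand g mu (v |: A) =
    if (#|A| == q) && (mdeg mu + s == j)%N then Psi mu (v |: A) else 0.
  move=> /BE/andP[Bmu /eqP Bc]; rewrite /strand gE /c subindK // Bc eqSS.
  have -> : X (mu - ind (v |: A))%MM.
    apply: Xdiv Xm; rewrite -[X in (_ <= X)%MM]mE; apply/mnm_lepP => i.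
    rewrite !mnmBE !indE !inE; apply: leq_sub2l.
    by case: (i \in A); rewrite ?orbT.
  have -> : mdeg mu = (mdeg (mu - ind (v |: A)) + #|A|.+1)%N.
    by rewrite -Bc -mdeg_ind -mdegD subindK.
  by rewrite andbT; case: eqP => // ->.
rewrite (@eq_kosZ _ _ _ (strand g mu)
  (fun B => if (#|A| == q) && (mdeg mu + s == j)%N then Psi mu B else 0)) //.
case: (boolP ((#|A| == q) && (mdeg mu + s == j)%N)) => [/andP[/eqP Aq /eqP muj]|nAj].
  rewrite -(PsiE mu muj A Amu _ Aq) /strand ?mE //.
rewrite /kosZ big1; last by move=> v _; rewrite mulr0.
apply/esym/memN_msupp_eq0/negP => /hf[Aq mj _].
by move: nAj; rewrite Aq eqxx /mu mdegD mdeg_ind Aq mj eqxx.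
Qed.

(** If a variable can always be moved from the exterior to the monomial factor, the
    strand is a cone with that variable as apex. *)
Lemma cone_strand Z (G : pred {set 'I_n}) v q : v \in Z ->
  (forall A, v \in A -> A \subset Z -> G A -> G (A :\ v)) -> strand_exact K Z G q.
Proof.
move=> vZ Gv; apply/vanishing_strand/(@vanishing_cone _ _ _ v) => F vF /andP[FZ GF].
rewrite /dual_family subUset sub1set vZ FZ /=.
have -> : Z :\: (v |: F) = (Z :\: F) :\ v by rewrite setUC setDDl.
by apply: Gv => //; rewrite ?subsetDl // inE vF.
Qed.

(** Over the polynomial ring only the strand of multidegree 0 is not a cone. *)
Lemma free_strand_solve q f mu (nz : mu != 0%MM \/ q != 0%N) :
  (forall A, A \subset msup mu -> #|A|.+1 = q -> kosZ (msup mu) (strand f mu) A = 0) ->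
  exists psi, forall A, A \subset msup mu -> true -> #|A| = q ->
    strand f mu A = kosZ (msup mu) psi A.
Proof.
move=> cyc; case: (set_0Vmem (msup mu)) => [Z0|[v vZ]]; last first.
  apply: (cone_strand (G := predT) vZ) => // A AZ _; exact: cyc.
exists (fun=> 0) => A; rewrite Z0 subset0 => /eqP-> _; rewrite cards0 => q0.
case: nz; rewrite -?q0 // => /negP[]; apply/eqP/mnmP => v.
by have := in_set0 v; rewrite -Z0 inE mnm0E lt0n => /negbFE/eqP.
Qed.

Lemma kos_exact j s q f : homogeneous predT j s q.+1 f -> (forall A, kos f A = 0) ->
  exists g : {ffun {set 'I_n} -> {mpoly K[n]}},
    homogeneous predT j s q.+2 g /\ forall A, kos g A = f A.
Proof.
move=> hf f0; have [|mu muj|g [hg gE]] := kos_lift _ hf; first by [].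
  apply: free_strand_solve; first by right.
  by move=> A AZ _; rewrite -kos_strand // f0 mcoeff0.
by exists g; split=> // A; rewrite -gE mrestr_id.
Qed.

Lemma kos_exact0 j s f : homogeneous predT j s 0 f -> (f set0)@_0 = 0 ->
  exists g : {ffun {set 'I_n} -> {mpoly K[n]}},
    homogeneous predT j s 1 g /\ forall A, kos g A = f A.
Proof.
move=> hf f0; have [|mu muj|g [hg gE]] := kos_lift _ hf; first by [].
  have [->|mu0] := eqVneq mu 0%MM; last by apply: free_strand_solve; first by left.
  exists (fun=> 0) => A _ _ /cards0_eq->; rewrite /strand sub0m f0 /kosZ big1 // => v _.
  by rewrite mulr0.
by exists g; split=> // A; rewrite -gE mrestr_id.
Qed.

End Koszul.

(** * Hochster's formula for edge ideals *)

Section StandardMonomials.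
Variables (K : fieldType) (n : nat) (e : rel 'I_n).
Hypotheses (e_sym : symmetric e) (e_irr : irreflexive e).
Implicit Types (A B F W Z : {set 'I_n}) (v : 'I_n) (m mu : 'X_{1..n}).

Definition standard m := indep e (msup m).

Lemma standard_div : divisor_closed standard.
Proof.
move=> m m' /mnm_lepP le /indepP sm; apply/indepP => u v.
by rewrite !inE => mu mv; apply: sm; rewrite inE; [apply: leq_trans mu _|apply: leq_trans mv _].
Qed.

Lemma mem_ideal_gen (R : comNzRingType) (gs : seq R) x : x \in gs -> x \in ideal_gen gs.
Proof.
move=> xg; apply/asboolP; have ix : (index x gs < size gs)%N by rewrite index_mem.
exists (fun i => (i == Ordinal ix)%:R); rewrite (bigD1 (Ordinal ix)) //= eqxx mul1r nth_index //.
by rewrite big1 ?addr0 // => i ni; rewrite (negbTE ni) mul0r.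
Qed.

(** The edge ideal is spanned by the monomials whose support contains an edge. *)
Lemma edge_idealE (p : {mpoly K[n]}) :
  (p \in ideal_gen (edge_gens K e)) <-> mrestr standard p = 0.
Proof.
split=> [/asboolP[c ->]|p0].
  rewrite mrestr_sum big1 // => i _.
  have /mapP[[u v]] := mem_nth 0 (ltn_ord i); rewrite mem_enum inE /= => euv ->.
  rewrite (@mrestrM _ _ _ pred0).
    by rewrite (_ : mrestr pred0 _ = 0) ?mul0r //; apply/mpolyP => m; rewrite mcoeff_restr mcoeff0.
  move=> m m'; rewrite -mpolyXD msuppX inE => /eqP->.
  apply/negbTE/negP => /indepP/(_ u v); rewrite euv !inE !mnmDE !mnm1E !eqxx.
  by rewrite !(addnC (m _)) addSn addnS => /(_ isT isT).
rewrite (mpolyE p) big_seq; apply: rpred_sum => m mp.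
have : ~~ standard m.
  apply: contraTN mp => sm; rewrite mcoeff_msupp negbK.
  by move: p0 => /(congr1 (mcoeff m)); rewrite mcoeff_restr sm mcoeff0 => ->.
move=> /forall_inPn[u mu /forall_inPn[v mv]]; rewrite negbK => euv.
rewrite !inE in mu mv.
have uv : u != v by apply: contraTneq euv => ->; rewrite e_irr.
have -> : 'X_[m] = 'X_[m - (U_(u) + U_(v))] * ('X_u * 'X_v) :> {mpoly K[n]}.
  rewrite -!mpolyXD submK //; apply/mnm_lepP => i; rewrite mnmDE !mnm1E.
  case: (eqVneq u i) uv => [<- uv|_ _]; first by rewrite eq_sym (negbTE uv) addn0.
  by case: eqP => // <-.
rewrite -mul_mpolyC mulrA; apply/ideal_gen_mull/mem_ideal_gen/mapP.
by exists (u, v) => //; rewrite mem_enum.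
Qed.

Lemma eq_vanishing (X Y : pred {set 'I_n}) j : X =1 Y -> vanishing K X j -> vanishing K Y j.
Proof.
move=> XY van c c0; have [|b bE] := van c; first by move=> F; rewrite XY; apply: c0.
by exists b => F YF; apply: bE; rewrite XY.
Qed.

Lemma msup_ind W : msup (ind W) = W.
Proof. by apply/setP => v; rewrite inE indE; case: (v \in W). Qed.

Lemma dual_standard W : dual_family W (fun A => standard (ind W - ind A)%MM) =1 face e W.
Proof.
move=> F; rewrite /dual_family /face; case: (boolP (F \subset W)) => //= FW.
congr (indep e _); apply/setP => v; rewrite inE mnmBE !indE inE.
by case: (boolP (v \in F)) => [/(subsetP FW)->|]; rewrite //= subnn.
Qed.

Definition standard_exact j q := forall f : {ffun {set 'I_n} -> {mpoly K[n]}},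
  homogeneous standard j 0 q.+1 f -> (forall A, mrestr standard (kos f A) = 0) ->
  exists g : {ffun {set 'I_n} -> {mpoly K[n]}},
    homogeneous standard j 0 q.+2 g /\ forall A, mrestr standard (kos g A) = f A.

(** A multidegree with an exponent above one gives a cone: lowering that exponent by
    one does not change the support.  A squarefree multidegree gives the cochains of
    the independence complex of its support, and conversely a cochain is a Koszul
    chain concentrated in one multidegree. *)
Lemma hochster j q : standard_exact j q <->
  forall W, #|W| = j -> (q < j)%N -> vanishing K (face e W) (j - q.+1).
Proof.
split=> [ex W Wj qj|van f hf f0]; last first.
  apply: (kos_lift standard_div hf) => mu; rewrite addn0 => muj.
  have cyc A : A \subset msup mu -> standard (mu - ind A)%MM -> #|A|.+1 = q.+1 ->
      kosZ (msup mu) (strand f mu) A = 0.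
    by move=> AZ XA _; apply: restr_cycle XA.
  suff ex : strand_exact K (msup mu) (fun A => standard (mu - ind A)%MM) q.+1.
    exact: (ex _ cyc).
  case: (EM (exists v, (1 < mu v)%N)) => [[v v2]|sqfree].
    apply: (@cone_strand _ _ _ _ v); first by rewrite inE ltnW.
    move=> A vA AZ; rewrite /standard; congr (is_true (indep e _)).
    apply/setP => u; rewrite !inE !mnmBE !indE !inE; case: (eqVneq u v) => [->|//].
    by rewrite vA /= subn0; lia.
  have muE : mu = ind (msup mu).
    apply/mnmP => v; rewrite indE inE; have : ~ (1 < mu v)%N by move=> v2; apply: sqfree; exists v.
    by case: (mu v) => [|[|k]].
  rewrite muE msup_ind; set Z := msup mu.
  have Zj : #|Z| = j by rewrite -mdeg_ind -muE.
  have [qj|jq] := ltnP q j.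
    apply: vanishing_strand; rewrite Zj; apply: eq_vanishing (van Z Zj qj) => F.
    by rewrite dual_standard.
  move=> phi _; exists phi => A /subset_leq_card AZ _ Aq.
  by move: AZ; rewrite Aq Zj; lia.
rewrite -[in X in vanishing _ _ X]Wj; apply: (eq_vanishing (dual_standard W)); apply: strand_vanishing; first by rewrite Wj.
move=> phi cyc.
pose f : {ffun {set 'I_n} -> {mpoly K[n]}} := [ffun A : {set 'I_n} =>
  if [&& A \subset W, #|A| == q.+1 & standard (ind W - ind A)%MM]
  then phi A *: 'X_[ind W - ind A] else 0].
have fE A m : (f A)@_m = if [&& A \subset W, #|A| == q.+1, standard (ind W - ind A)%MM
    & (ind W - ind A)%MM == m] then phi A else 0.
  rewrite ffunE; case: and3P => [[-> -> ->]|nA] /=.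
    by rewrite mcoeffZ mcoeffX; case: eqP; rewrite ?mulr1 ?mulr0.
  by rewrite mcoeff0 ifF //; apply/negbTE/negP => /and4P[*]; apply: nA.
have hf : homogeneous standard j 0 q.+1 f.
  move=> A m; rewrite mcoeff_msupp fE; case: ifP; last by rewrite eqxx.
  move=> /and4P[AW /eqP Aq sA /eqP <-] _; split=> //.
  by rewrite addn0 -Aq -mdeg_ind -mdegD subindK ?msup_ind // mdeg_ind.
have kosE A : mrestr standard (kos f A) = 0.
  apply/mpolyP => m; rewrite mcoeff_restr mcoeff0; case: ifP => // sm.
  rewrite kos_coeff; set mu := (m + ind A)%MM.
  have mE : (mu - ind A)%MM = m by rewrite addmK.
  have Amu : A \subset msup mu by apply: sub_msup_add.
  have BE v : v \in msup mu :\: A -> v |: A \subset msup mu.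
    by rewrite inE => /andP[vA vmu]; rewrite subUset sub1set vmu Amu.
  have [muW|nmuW] := eqVneq mu (ind W); last first.
    rewrite /kosZ big1 // => v /BE Bmu; rewrite /strand fE ifF ?mulr0 //.
    apply/negbTE; apply: contra nmuW => /and4P[BW _ _ /eqP E].
    by rewrite -(subindK Bmu) -E subindK ?msup_ind.
  rewrite {}muW in mE Amu BE *; rewrite msup_ind in Amu BE *.
  have [Aq|nAq] := eqVneq #|A| q; last first.
    rewrite /kosZ big1 // => v; rewrite inE => /andP[vA _].
    by rewrite /strand fE cardsU1 vA eqSS (negbTE nAq) andbF mulr0.
  rewrite -[RHS](cyc A) ?mE ?Aq //; apply: eq_kosZ => v vZ.
  have vA : v \notin A by move: vZ; rewrite inE => /andP[].
  rewrite /strand fE BE // cardsU1 vA Aq !eqxx andbT /= ifT //.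
  apply: standard_div sm; rewrite -[X in (_ <= X)%MM]mE; apply/mnm_lepP => i.
  by rewrite !mnmBE !indE !inE; apply: leq_sub2l; case: (i \in A); rewrite ?orbT.
have [g [hg gE]] := ex f hf kosE.
exists (strand g (ind W)) => A AW sA Aq.
have := congr1 (mcoeff (ind W - ind A)%MM) (gE A).
rewrite mcoeff_restr sA kos_strand ?msup_ind // => ->.
by rewrite fE AW Aq sA !eqxx.
Qed.

End StandardMonomials.

(** * The Koszul double complex of a graded resolution *)

Section KoszulMore.
Variables (K : fieldType) (n : nat).
Implicit Types (A B F Z : {set 'I_n}) (v : 'I_n) (m mu : 'X_{1..n}).
Implicit Types (f g : {set 'I_n} -> {mpoly K[n]}) (X : pred 'X_{1..n}).

Lemma kos_mulr f p A : kos (fun B => f B * p) A = kos f A * p.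
Proof.
by rewrite /kos mulr_suml; apply: eq_bigr => v _; rewrite mulrA scalerAl.
Qed.

Lemma kos_sum (I : finType) (f : I -> {set 'I_n} -> {mpoly K[n]}) A :
  kos (fun B => \sum_i f i B) A = \sum_i kos (f i) A.
Proof.
rewrite /kos exchange_big; apply: eq_bigr => v _.
by rewrite mulr_sumr scaler_sumr.
Qed.

Lemma restr_kos X f A : divisor_closed X ->
  mrestr X (kos (fun B => mrestr X (f B)) A) = mrestr X (kos f A).
Proof.
move=> Xdiv; apply/mpolyP => m; rewrite !mcoeff_restr; case: ifP => // Xm.
rewrite !kos_coeff; apply: eq_kosZ => v _; rewrite /strand mcoeff_restr ifT //.
apply: Xdiv Xm; apply/mnm_lepP => i; rewrite mnmBE mnmDE !indE !inE.
by case: (i \in A); rewrite ?orbT ?addnK // addn0 leq_subr.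
Qed.

Lemma homogeneousB X j s q f g : homogeneous X j s q f -> homogeneous X j s q g ->
  homogeneous X j s q (fun A => f A - g A).
Proof.
by move=> hf hg A m /msuppB_le; rewrite mem_cat => /orP[/hf|/hg].
Qed.

Lemma homogeneous_kos X j s q f : homogeneous X j s q.+1 f ->
  homogeneous predT j s q (kos f).
Proof.
move=> hf A m /msupp_sum_le/flatten_mapP[v]; rewrite mem_filter => /andP[vA _].
move=> /msuppZ_le; rewrite mulrC (perm_mem (msuppMX _ _)) => /mapP[m' + ->].
move=> /hf[Aq E _]; rewrite mdegD mdeg1; split=> //; last by rewrite -E; lia.
by move: Aq; rewrite cardsU1 vA => -[].
Qed.

Lemma kos_set0_coeff0 f : (kos f set0)@_0 = 0.
Proof.
by rewrite raddf_sum big1 // => v _; rewrite /= mcoeffZ mcoeff_mulU mnm0E mulr0.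
Qed.

End KoszulMore.

Section Resolution.
Variables (K : fieldType) (n : nat) (e : rel 'I_n).
Hypothesis e_irr : irreflexive e.
Variables (F : graded_free_resolution (edge_gens K e)) (j : nat).
Local Notation S := {mpoly K[n]}.
Local Notation std := (standard e).

(** Koszul chains with coefficients in the [p]-th free module, in all exterior degrees
    at once; [chain_deg] selects the exterior degree. *)
Definition chains p := {ffun {set 'I_n} -> 'rV[S]_(rk F p)}.

Definition chain_deg p q (f : chains p) : Prop :=
  forall k, homogeneous predT j (shift k) q (fun A => f A 0 k).

Definition diff_chain p (f : chains p.+1) : chains p := [ffun A => f A *m diff F p].

Definition kos_chain p (f : chains p) : chains p :=
  [ffun A => \row_k kos (fun B => f B 0 k) A].

Lemma aug_rep : exists P : 'I_(rk F 0) -> S, forall k,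
  P k \is (shift k).-homog /\ aug F (delta_mx 0 k) = quot_class _ (P k).
Proof.
have /choice[P PE] : forall k, exists p : S,
    p \is (shift k).-homog /\ aug F (delta_mx 0 k) = quot_class _ p.
  by move=> k; have [p hp pE] := aug_graded k; exists p.
by exists P.
Qed.

(** The polynomials [P k] are homogeneous representatives of the images of the basis
    vectors under the augmentation; they replace S/I by normal forms in S. *)
Section Augmentation.
Variable P : 'I_(rk F 0) -> S.
Hypothesis P_homog : forall k, P k \is (shift k).-homog.
Hypothesis P_aug : forall k, aug F (delta_mx 0 k) = quot_class _ (P k).

Lemma quot_class0 : quot_class (edge_gens K e) 0 = 0.
Proof. by have /eqP := quot_classD (edge_gens K e) 0 0; rewrite addr0 -subr_eq subrr => /eqP. Qed.

Definition aug_poly (x : 'rV[S]_(rk F 0)) : S := \sum_k x 0 k * P k.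

Lemma aug_polyE x : aug F x = quot_class _ (aug_poly x).
Proof.
have -> : quot_class (edge_gens K e) (aug_poly x) = \sum_k quot_class _ (x 0 k * P k).
  exact: (big_morph _ (@quot_classD _ _) quot_class0).
rewrite {1}(row_sum_delta x) raddf_sum; apply: eq_bigr => k _.
by rewrite /= linearZ /= P_aug; apply: quot_scaleE.
Qed.

Lemma aug_eq0 x : aug F x = 0 <-> mrestr std (aug_poly x) = 0.
Proof.
rewrite -quot_class0 aug_polyE -(edge_idealE e_irr); split=> [/quot_classP|]; first by rewrite subr0.
by move=> I; apply/quot_classP; rewrite subr0.
Qed.

Lemma aug_polyB x y : aug_poly (x - y) = aug_poly x - aug_poly y.
Proof. by rewrite /aug_poly -sumrB; apply: eq_bigr => k _; rewrite !mxE mulrBl. Qed.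

Definition aug_chain (f : chains 0) : {ffun {set 'I_n} -> S} :=
  [ffun A => mrestr std (aug_poly (f A))].

Definition const_row p (f : chains p) : 'rV[K]_(rk F p) := map_mx (mcoeff 0%MM) (f set0).

Definition row_deg p (x : 'rV[K]_(rk F p)) : Prop :=
  forall k, x 0 k != 0 -> shift k = j.

Definition kos_std (f : {ffun {set 'I_n} -> S}) : {ffun {set 'I_n} -> S} :=
  [ffun A => mrestr std (kos f A)].

(** Homogeneous components of solutions are solutions, since the matrices of a
    graded resolution shift degrees consistently. *)
Definition degree_pred (A : {set 'I_n}) q s : pred 'X_{1..n} :=
  fun m => (#|A| == q) && (mdeg m + q + s == j)%N.

Definition project p q (x : {set 'I_n} -> 'rV[S]_(rk F p)) : chains p :=
  [ffun A => \row_k mrestr (degree_pred A q (shift k)) (x A 0 k)].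

Lemma project_deg p q x : chain_deg q (@project p q x).
Proof.
move=> k A m; rewrite ffunE mxE mcoeff_msupp mcoeff_restr; case: ifP; last by rewrite eqxx.
by move=> /andP[/eqP Aq /eqP mj] _; split.
Qed.

Lemma project_diff p q x A l : (@project p.+1 q x A *m diff F p) 0 l =
  mrestr (degree_pred A q (shift l)) ((x A *m diff F p) 0 l).
Proof.
rewrite !mxE mrestr_sum; apply: eq_bigr => k _; rewrite ffunE mxE.
rewrite (mrestrM (Y := degree_pred A q (shift k))) // => m m' /diff_graded E.
by rewrite /degree_pred -E mdegD; congr (_ && (_ == _)); lia.
Qed.

Lemma project_aug q x A : aug_poly (@project 0 q x A) =
  mrestr (degree_pred A q 0) (aug_poly (x A)).
Proof.
rewrite /aug_poly mrestr_sum; apply: eq_bigr => k _; rewrite ffunE mxE.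
rewrite (mrestrM (Y := degree_pred A q (shift k))) // => m m' /(dhomog_mf (P_homog k)) /= E.
by rewrite /degree_pred -E mdegD; congr (_ && (_ == _)); lia.
Qed.

Lemma chain_eq p q (f g : chains p) : chain_deg q f ->
  (forall A k, g A 0 k = mrestr (degree_pred A q (shift k)) (f A 0 k)) -> g = f.
Proof.
move=> hf gE; apply/ffunP => A; apply/rowP => k; rewrite gE mrestr_id // => m.
by move=> /hf[/eqP Aq /eqP mj _]; rewrite /degree_pred Aq mj.
Qed.

Lemma lift_chain p q (y : chains p) : chain_deg q y ->
  (forall A, exists x, x *m diff F p = y A) ->
  exists2 x : chains p.+1, chain_deg q x & diff_chain x = y.
Proof.
move=> hy /choice[x xE]; exists (project q x); first exact: project_deg.
by apply: (chain_eq hy) => A k; rewrite ffunE project_diff xE.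
Qed.

Lemma row_chain p q (G : 'I_(rk F p) -> {ffun {set 'I_n} -> S}) :
  (forall k, homogeneous predT j (shift k) q (G k)) ->
  exists2 g : chains p, chain_deg q g & forall A k, g A 0 k = G k A.
Proof.
move=> hG; exists [ffun A => \row_k G k A] => [k A m|A k]; rewrite ffunE mxE //.
exact: hG.
Qed.

Lemma diff_chain_deg p q (f : chains p.+1) : chain_deg q f -> chain_deg q (diff_chain f).
Proof.
move=> hf l A m; rewrite ffunE mxE => /msupp_sum_le/flatten_mapP[k _].
move=> /msuppM_le/allpairsP[[m1 m2] /= [/hf[Aq E _] /diff_graded E2 ->]].
by split=> //; rewrite mdegD; lia.
Qed.

Lemma kos_chain_deg p q (f : chains p) : chain_deg q.+1 f -> chain_deg q (kos_chain f).
Proof. by move=> hf k A m; rewrite ffunE mxE; apply: homogeneous_kos. Qed.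

Lemma aug_chain_deg q (f : chains 0) : chain_deg q f -> homogeneous std j 0 q (aug_chain f).
Proof.
move=> hf A m; rewrite ffunE mcoeff_msupp mcoeff_restr; case: ifP => [sm|]; last by rewrite eqxx.
rewrite -mcoeff_msupp => /msupp_sum_le/flatten_mapP[k _].
move=> /msuppM_le/allpairsP[[m1 m2] /= [/hf[Aq E _] /(dhomog_mf (P_homog k)) /= E2 mE]].
by split=> //; rewrite mE mdegD; lia.
Qed.

Lemma const_row_deg p (f : chains p) : chain_deg 0 f -> row_deg (const_row f).
Proof.
move=> hf k; rewrite mxE -mcoeff_msupp => /hf[_ + _].
by rewrite mdeg0.
Qed.

Lemma diff_kos p (f : chains p.+1) : diff_chain (kos_chain f) = kos_chain (diff_chain f).
Proof.
apply/ffunP => A; apply/rowP => l; rewrite !ffunE !mxE.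
transitivity (\sum_k kos (fun B => f B 0 k * diff F p k l) A).
  by apply: eq_bigr => k _; rewrite mxE kos_mulr.
by rewrite -kos_sum; apply: eq_kos => B; rewrite ffunE mxE.
Qed.

Lemma aug_kos (f : chains 0) : aug_chain (kos_chain f) = kos_std (aug_chain f).
Proof.
apply/ffunP => A; rewrite !ffunE.
have -> : kos (aug_chain f) A = kos (fun B => mrestr std (aug_poly (f B))) A.
  by apply: eq_kos => B; rewrite ffunE.
rewrite restr_kos; last exact: standard_div.
congr mrestr; rewrite /aug_poly kos_sum; apply: eq_bigr => k _.
by rewrite mxE kos_mulr.
Qed.

Lemma const_diff p (f : chains p.+1) : const_row (diff_chain f) = const_row f *m diffK F p.
Proof. by rewrite /const_row ffunE map_mxM. Qed.

Lemma diff_diff p (f : chains p.+2) : diff_chain (diff_chain f) = 0.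
Proof.
have [_ _ exS] := gfr_exact F.
apply/ffunP => A; rewrite !ffunE; apply/exS.
by exists (f A).
Qed.

Lemma kos_kos_chain p (f : chains p) : kos_chain (kos_chain f) = 0.
Proof.
apply/ffunP => A; apply/rowP => k; rewrite !ffunE !mxE -[RHS](kos_kos (fun B => f B 0 k) A).
by apply: eq_kos => B; rewrite ffunE mxE.
Qed.

Lemma aug_diff (f : chains 1) : aug_chain (diff_chain f) = 0.
Proof.
have [_ ex0 _] := gfr_exact F.
by apply/ffunP => A; rewrite !ffunE; apply/aug_eq0/ex0; exists (f A).
Qed.

Lemma const_kos p (f : chains p) : const_row (kos_chain f) = 0.
Proof. by apply/rowP => k; rewrite !mxE ffunE mxE kos_set0_coeff0. Qed.

Lemma exact_diff p q : exact_at (@diff_chain p.+1) (@diff_chain p)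
  (@chain_deg p.+2 q) (@chain_deg p.+1 q).
Proof.
have [_ _ exS] := gfr_exact F.
move=> y hy /ffunP y0; apply: (lift_chain hy) => A; apply/exS.
by have := y0 A; rewrite !ffunE.
Qed.

Lemma exact_aug q : exact_at (@diff_chain 0) aug_chain (@chain_deg 1 q) (@chain_deg 0 q).
Proof.
have [_ ex0 _] := gfr_exact F.
move=> y hy /ffunP y0; apply: (lift_chain hy) => A; apply/ex0/aug_eq0.
by have := y0 A; rewrite !ffunE.
Qed.

Lemma exact_kos p q : exact_at (@kos_chain p) (@kos_chain p)
  (@chain_deg p q.+2) (@chain_deg p q.+1).
Proof.
move=> y hy /ffunP y0.
have /choice[G GE] : forall k, exists g : {ffun {set 'I_n} -> S},
    homogeneous predT j (shift k) q.+2 g /\ forall A, kos g A = y A 0 k.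
  move=> k; apply: kos_exact (hy k) _ => A.
  by have := y0 A; rewrite !ffunE => /rowP/(_ k); rewrite !mxE.
have [g hg gE] := row_chain (fun k => (GE k).1).
exists g => //; apply/ffunP => A; apply/rowP => k; rewrite !ffunE !mxE -(GE k).2.
by apply: eq_kos => B; rewrite gE.
Qed.

Lemma exact_const p : exact_at (@kos_chain p) (@const_row p) (@chain_deg p 1) (@chain_deg p 0).
Proof.
move=> y hy /rowP y0.
have /choice[G GE] : forall k, exists g : {ffun {set 'I_n} -> S},
    homogeneous predT j (shift k) 1 g /\ forall A, kos g A = y A 0 k.
  move=> k; apply: kos_exact0 (hy k) _.
  by have := y0 k; rewrite !mxE.
have [g hg gE] := row_chain (fun k => (GE k).1).
exists g => //; apply/ffunP => A; apply/rowP => k; rewrite !ffunE !mxE -(GE k).2.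
by apply: eq_kos => B; rewrite gE.
Qed.

(** Normal forms are already homogeneous, so the component of a preimage in the right
    degree is a preimage. *)
Lemma aug_onto q (y : {ffun {set 'I_n} -> S}) : homogeneous std j 0 q y ->
  exists2 x, chain_deg q x & aug_chain x = y.
Proof.
have [surj _ _] := gfr_exact F.
move=> hy; have /choice[x xE] := fun A => surj (quot_class (edge_gens K e) (y A)).
exists (project q x); first exact: project_deg.
apply/ffunP => A; rewrite ffunE project_aug.
have yE : mrestr std (aug_poly (x A)) = y A.
  have /quot_classP := etrans (esym (aug_polyE (x A))) (xE A).
  move=> /(edge_idealE e_irr)/eqP; rewrite mrestrB subr_eq0 => /eqP->.
  by rewrite mrestr_id // => m /hy[].
apply/mpolyP => m; rewrite -yE !mcoeff_restr; case: ifP => // sm; case: ifP => // dm.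
have := mcoeff_restr std (aug_poly (x A)) m; rewrite sm yE => <-.
apply/esym/memN_msupp_eq0/negP => /hy[/eqP Aq /eqP mj _].
by rewrite /degree_pred Aq mj in dm.
Qed.

Lemma const_onto p (y : 'rV[K]_(rk F p)) : row_deg y ->
  exists2 x, chain_deg 0 x & const_row x = y.
Proof.
move=> hy; exists [ffun A => if A == set0 then \row_k (y 0 k)%:MP else 0].
  move=> k A m; rewrite ffunE; case: eqP => [->|_]; last by rewrite mxE msupp0.
  rewrite mxE msuppC; case: eqP => // /eqP/hy E; rewrite inE => /eqP->.
  by rewrite cards0 mdeg0 E.
by apply/rowP => k; rewrite !mxE ffunE eqxx mxE mcoeffC eqxx mulr1.
Qed.

Definition resolution_complex : double_complex.
Proof.
refine (@DoubleComplex (fun p q => chains p) (fun q => {ffun {set 'I_n} -> S})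
  (fun p => 'rV[K]_(rk F p)) (fun p q => @diff_chain p) (fun p q => @kos_chain p)
  (fun q => aug_chain) (fun p => @const_row p) (fun q => kos_std)
  (fun p x => x *m diffK F p)
  (fun p q => @chain_deg p q) (fun q f => homogeneous std j 0 q f) (fun p => @row_deg p)
  _ _ _ _ _ (@diff_chain_deg) (@kos_chain_deg) (@aug_chain_deg) (@const_row_deg)
  (fun p q => @diff_kos p) (fun q => aug_kos) (@const_diff) (fun p q => @diff_diff p)
  (fun p q => @kos_kos_chain p) (fun q => aug_diff) (@const_kos)
  (@exact_diff) (@exact_kos) (@exact_aug) (@exact_const) (@aug_onto) (@const_onto)).
- move=> p q x y hx hy k A m; rewrite !ffunE !mxE.
  exact: (homogeneousB (hx k) (hy k)).
- by move=> p q x y; apply/ffunP => A; rewrite !ffunE mulmxBl.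
- move=> p q x y; apply/ffunP => A; apply/rowP => k; rewrite !ffunE !mxE -kosB.
  by apply: eq_kos => B; rewrite !ffunE !mxE.
- by move=> q x y; apply/ffunP => A; rewrite !ffunE aug_polyB mrestrB.
- by move=> p x y; apply/rowP => k; rewrite !mxE !ffunE !mxE mcoeffB.
Defined.

(** The two edges of the double complex are the Koszul complex of S/I and F tensored
    with K. *)
Lemma resolution_exact i : standard_exact K e j i <->
  forall y : 'rV[K]_(rk F i.+1), row_deg y -> y *m diffK F i = 0 ->
  exists2 x, row_deg x & x *m diffK F i.+1 = y.
Proof.
have [MN NM] := balance_iff resolution_complex i; split=> ex.
  apply: MN => f hf /ffunP f0; have [|g [hg gE]] := ex f hf.
    by move=> A; have := f0 A; rewrite !ffunE.
  by exists g => //; apply/ffunP => A; rewrite ffunE gE.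
move=> f hf f0; have [|g hg /ffunP gE] := NM ex f hf.
  by apply/ffunP => A; rewrite !ffunE f0.
by exists g; split=> // A; have := gE A; rewrite ffunE.
Qed.

End Augmentation.
End Resolution.

(** * Betti numbers and maximal shifts *)

Section Betti.
Variables (K : fieldType) (n : nat) (e : rel 'I_n).
Hypotheses (e_sym : symmetric e) (e_irr : irreflexive e).
Variables (F : graded_free_resolution (edge_gens K e)).

Lemma row_degP j p (y : 'rV[K]_(rk F p)) :
  reflect (row_deg j y) (y <= degree_part F p j)%MS.
Proof.
apply: (iffP submxP) => [[D ->] k|hy].
  by rewrite mul_mx_diag !mxE; have [//|_] := eqVneq (shift k) j; rewrite mulr0 eqxx.
exists y; apply/rowP => k; rewrite mul_mx_diag !mxE.
by have [->|/hy->] := eqVneq (y 0 k) 0; rewrite ?mul0r // eqxx mulr1.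
Qed.

Lemma diffK_diffK p : diffK F p.+1 *m diffK F p = 0.
Proof.
rewrite -map_mxM (_ : diff F p.+1 *m diff F p = 0) ?map_mx0 //.
have [_ _ exS] := gfr_exact F.
apply/row_matrixP => k; rewrite row0 row_mul rowE; apply/exS.
by exists (delta_mx 0 k).
Qed.

Lemma diffK_deg p k l : diffK F p k l != 0 -> shift k = shift l.
Proof. by rewrite mxE -mcoeff_msupp => /diff_graded; rewrite mdeg0. Qed.

Lemma row_deg_diffK j p (x : 'rV[K]_(rk F p.+1)) : row_deg j x -> row_deg j (x *m diffK F p).
Proof.
move=> hx l nz; apply: contrapT => nl; case/eqP: nz; rewrite mxE big1 // => k _.
have [->|/hx xk] := eqVneq (x 0 k) 0; first by rewrite mul0r.
have [->|/diffK_deg E] := eqVneq (diffK F p k l) 0; first by rewrite mulr0.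
by rewrite -E in nl.
Qed.

(** Needed because the Betti number is a truncated difference of ranks. *)
Lemma boundaries_sub_cycles i j : (Tor_boundaries F i.+1 j <= Tor_cycles F i.+1 j)%MS.
Proof.
rewrite sub_capmx; apply/andP; split; last first.
  by apply/sub_kermxP; rewrite -mulmxA diffK_diffK mulmx0.
apply/rV_subP => _ /submxP[D ->]; rewrite mulmxA; apply/row_degP/row_deg_diffK.
by apply/row_degP; apply: submxMl.
Qed.

Lemma betti_eq0 i j : betti F i.+1 j = 0%N <->
  forall y : 'rV[K]_(rk F i.+1), row_deg j y -> y *m diffK F i = 0 ->
  exists2 x, row_deg j x & x *m diffK F i.+1 = y.
Proof.
rewrite /betti; have rk_eq := mxrank_leqif_sup (boundaries_sub_cycles i j).
have -> : (\rank (Tor_cycles F i.+1 j) - \rank (Tor_boundaries F i.+1 j) = 0)%N <->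
    (Tor_cycles F i.+1 j <= Tor_boundaries F i.+1 j)%MS.
  rewrite -rk_eq eqn_leq rk_eq.1 /= -subn_eq0; split; first by move->.
  by move/eqP.
split=> [/rV_subP sub y hy y0|ex].
  have /submxP[D ->] : (y <= Tor_boundaries F i.+1 j)%MS.
    by apply: sub; rewrite sub_capmx; apply/andP; split; [apply/row_degP|apply/sub_kermxP].
  exists (D *m degree_part F i.+2 j); last by rewrite mulmxA.
  by apply/row_degP; apply: submxMl.
apply/rV_subP => y; rewrite sub_capmx => /andP[/row_degP hy /sub_kermxP y0].
have [x /row_degP/submxP[D ->] <-] := ex y hy y0.
by rewrite -mulmxA; apply: submxMl.
Qed.

Lemma betti_shift i j : betti F i.+1 j != 0%N -> exists k : 'I_(rk F i.+1), shift k = j.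
Proof.
move=> nz; apply: contrapT => nk; case/eqP: nz; apply/betti_eq0 => y hy _.
exists 0; first by move=> k; rewrite mxE eqxx.
rewrite mul0mx; apply/esym/rowP => k; rewrite mxE; apply/eqP; apply: contraT => /hy E.
by case: nk; exists k.
Qed.

Lemma betti_hochster i j :
  betti F i.+1 j != 0%N <-> exists2 k, j = (i.+1 + k)%N & betti_support K e i.+1 k.
Proof.
have [Q QE] := aug_rep F.
have res := resolution_exact e_irr j (fun k => (QE k).1) (fun k => (QE k).2) i.
have betti_van : betti F i.+1 j = 0%N <->
    forall W : {set 'I_n}, #|W| = j -> (i < j)%N -> vanishing K (face e W) (j - i.+1).
  by apply: iff_trans (betti_eq0 i j) _; apply: iff_trans (iff_sym res) _; apply: hochster.
split=> [nz|[k jE [W Wc hW]]]; last first.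
  apply/eqP => /betti_van/(_ W); rewrite Wc -jE => /(_ erefl).
  by rewrite {1}jE addSn ltnS leq_addr jE addKn => /(_ isT).
apply: contrapT => noP; case/eqP: nz; apply/betti_van => W Wj ij.
apply: contrapT => hW; apply: noP; exists (j - i.+1)%N; first by rewrite subnKC.
by exists W => //; rewrite subnKC.
Qed.

Lemma max_shift_ge i k : betti_support K e i.+1 k -> (i.+1 + k <= max_shift F i.+1)%N.
Proof.
move=> Pik; have nz : betti F i.+1 (i.+1 + k) != 0%N by apply/betti_hochster; exists k.
have [l lE] := betti_shift nz.
by rewrite -lE in nz *; apply: leq_bigmax_cond.
Qed.

End Betti.

(** For a = 0 the inequality is trivial.  Otherwise each shift contributing to the
    left-hand side comes from a vertex set to which [subadditivity] applies. *)
Theorem theorem3p4 (K : fieldType) (n : nat) (e : rel 'I_n)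
  (e_sym : symmetric e) (e_irr : irreflexive e)
  (F : graded_free_resolution (edge_gens K e))
  (pd : nat) (pdE : is_projdim (edge_quotient K e) pd)
  (a : nat) (a_pd : (a + 4 <= pd)%N) :
  (max_shift F (a + 4) <= max_shift F a + max_shift F 4)%N.
Proof.
case: a {a_pd} => [|a]; first exact: leq_addl.
apply/bigmax_leqP => k nz.
have /(betti_hochster e_irr)[l -> Pl] : betti F (a + 4).+1 (shift k) != 0%N by exact: nz.
have [j [s [Pj Ps ljs]]] := subadditivity e_sym e_irr (ltn0Sn a) Pl.
apply: leq_trans (leq_add (max_shift_ge e_irr F Pj) (max_shift_ge e_irr F Ps)).
by rewrite addSn; lia.
Qed.
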